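(* Let $G$ be a discrete group having a strongly faithful, minimal action of general type on a tree $T$, and let $H$ be a nontrivial normal subgroup of $G$. Then $H\le G$ is $C^*$-irreducible. Moreover, $(H\le G,\sigma)$ is $C^*$-irreducible for every two-cocycle $\sigma$ on $G$.
   Context: Actions on trees are by tree automorphisms. An automorphism of a tree $T$ is elliptic if it fixes a vertex, an inversion if it fixes no vertex but permutes two adjacent vertices, and hyperbolic otherwise. A hyperbolic automorphism $h$ acts by translation on an infinite linear subtree (its axis) and has exactly two fixed points in $T\cup\partial T$, namely the two boundary points in $\partial T$ determined by the axis. Two hyperbolic automorphisms are transverse if their fixed point sets are disjoint. An action of $G$ on $T$ is minimal if $T$ contains no proper $G$-invariant subtree, and of general type if the image of $G$ in $\mathrm{Aut}(T)$ contains two transverse hyperbolic automorphisms. An action of $G$ on a set $X$ (here the vertices of $T$) is strongly faithful if for every finite subset $F\subseteq G\setminus\{e\}$ there exists $x\in X$ such that $fx\ne x$ for all $f\in F$. A two-cocycle on $G$ (identity $e$) is a map $\sigma\colon G\times G\to\mathbb{T}$ (unit circle) with $\sigma(g,h)\sigma(gh,k)=\sigma(g,hk)\sigma(h,k)$ and $\sigma(g,e)=\sigma(e,g)=1$ for all $g,h,k\in G$. The operators $\lambda_\sigma(g)$ on $\ell^2(G)$ are given by $(\lambda_\sigma(g)\xi)(h)=\sigma(g,g^{-1}h)\xi(g^{-1}h)$. $C^*_r(G,\sigma)$ is the $C^*$-subalgebra of $B(\ell^2(G))$ generated by $\lambda_\sigma(G)$, and $C^*_r(H,\sigma)$ is identified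 with its $C^*$-subalgebra generated by $\lambda_\sigma(H)$. $(H\le G,\sigma)$ is $C^*$-irreducible if every $C^*$-algebra $C$ with $C^*_r(H,\sigma)\subseteq C\subseteq C^*_r(G,\sigma)$ is simple; $H\le G$ is $C^*$-irreducible if this holds for the trivial cocycle $\sigma\equiv1$. *)

(* Defs.v *)
From HB Require Import structures.
From mathcomp Require Import all_boot all_order all_algebra.
From mathcomp Require Import boolp classical_sets functions cardinality.
From mathcomp Require Import reals ereal esum numfun.
From mathcomp Require Import complex.
From mathcomp Require Import ring.

Set Implicit Arguments.
Unset Strict Implicit.
Unset Printing Implicit Defensive.

Import Order.TTheory GRing.Theory Num.Theory.
Local Open Scope classical_set_scope.
Local Open Scope ring_scope.

Section Trees.
Variables (V : eqType) (adj : rel V).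

Definition is_tree : Prop :=
  [/\ (exists x : V, True), symmetric adj, irreflexive adj,
      (forall x y, exists2 p, path adj x p & last x p = y)
    & (forall c, (2 < size c)%N -> ~ ucycle adj c)].

Definition elliptic (f : V -> V) : Prop := exists x, f x = x.

Definition inversion (f : V -> V) : Prop :=
  ~ elliptic f /\ exists x y, [/\ adj x y, f x = y & f y = x].

Definition hyperbolic (f : V -> V) : Prop := ~ elliptic f /\ ~ inversion f.

Definition ray (r : nat -> V) : Prop :=
  (forall n, adj (r n) (r n.+1)) /\ injective r.

Definition cofinal (r s : nat -> V) : Prop :=
  exists m n, forall k, r (m + k)%N = s (n + k)%N.

(* A point of the boundary is a cofinality class of rays. *)
Definition boundary : set (set (nat -> V)) :=
  [set xi | exists2 r, ray r & xi = [set s | ray s /\ cofinal r s]].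

(* Fixed points in the disjoint union of T and its boundary; an automorphism f
   maps the class xi to {f \o r | r in xi}. *)
Definition fixed_points (f : V -> V) : set (V + set (nat -> V)) :=
  [set p | match p with
           | inl x => f x = x
           | inr xi => boundary xi /\ [set f \o r | r in xi] = xi
           end].

Definition transverse (f g : V -> V) : Prop :=
  fixed_points f `&` fixed_points g = set0.

(* A connected subgraph of a tree is an induced subgraph, so that a subtree is
   determined by its vertex set. *)
Definition subtree (S : set V) : Prop :=
  S !=set0 /\
  forall x y, S x -> S y ->
    exists p, [/\ path adj x p, last x p = y & forall z, z \in p -> S z].

Section Action.
Variables (G : groupType) (act : G -> V -> V).

Definition tree_action : Prop :=
  [/\ (forall x, act 1%g x = x),
      (forall g h x, act (g * h)%g x = act g (act h x))
    & (forall g x y, adj (act g x) (act g y) = adj x y)].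

Definition strongly_faithful : Prop :=
  forall F : set G, finite_set F -> ~ F 1%g ->
    exists x, forall f, F f -> act f x <> x.

Definition minimal_action : Prop :=
  forall S, subtree S -> (forall g x, S x -> S (act g x)) -> S = setT.

Definition general_type : Prop :=
  exists g h, [/\ hyperbolic (act g), hyperbolic (act h)
                & transverse (act g) (act h)].

End Action.
End Trees.

Definition normal_subgroup (G : groupType) (H : {pred G}) : Prop :=
  group_closed H /\ forall g h, h \in H -> (h ^ g)%g \in H.

Definition nontrivial_subgroup (G : groupType) (H : {pred G}) : Prop :=
  exists2 h, h \in H & h <> 1%g.

Section Ell2.
Variables (R : realType) (I : choiceType).

Local Notation normc := ComplexField.Normc.normc.

Definition sqnorm (f : I -> R[i]) : \bar R :=
  \esum_(i in [set: I]) (normc (f i) ^+ 2)%:E.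

Definition square_summable : {pred I -> R[i]} :=
  fun f => `[< (sqnorm f < +oo)%E >].

Lemma square_summable_le (M : R) (f g : I -> R[i]) :
  (forall i, normc (f i) ^+ 2 <= M * normc (g i) ^+ 2) ->
  g \in square_summable -> f \in square_summable.
Proof.
move=> fg /asboolP gS; apply/asboolP.
pose N := `|M|; have N0 : 0 <= N by rewrite normr_ge0.
have gfin : sqnorm g \is a fin_num.
  by rewrite ge0_fin_numE// esum_ge0// => i _; rewrite lee_fin sqr_ge0.
apply: (@le_lt_trans _ _ (N%:E * sqnorm g)%E); last first.
  by rewrite -(fineK gfin) -EFinM ltry.
apply: ge_ereal_sup => _ [X [finX _] <-].
apply: (@le_trans _ _ (\sum_(i \in X) (N%:E * (normc (g i) ^+ 2)%:E))%E).
  apply: lee_fsum => // i _; rewrite -EFinM lee_fin (le_trans (fg i))//.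
  by rewrite ler_wpM2r ?sqr_ge0// ler_norm.
rewrite -ge0_mule_fsumr; last by move=> i; rewrite lee_fin sqr_ge0.
by apply: lee_wpmul2l; rewrite ?lee_fin//; apply: esum_ge; exists X.
Qed.

Lemma normcD_sqr_le (x y : R[i]) :
  normc (x + y) ^+ 2 <= 2 * normc x ^+ 2 + 2 * normc y ^+ 2.
Proof.
case: x y => [a b] [c d] /=; rewrite !sqr_sqrtr ?addr_ge0 ?sqr_ge0//.
rewrite -subr_ge0 (_ : _ - _ = (a - c) ^+ 2 + (b - d) ^+ 2); last by ring.
by rewrite addr_ge0 ?sqr_ge0.
Qed.

Fact square_summable_submod : submod_closed square_summable.
Proof.
split=> [|a f g fS gS].
  apply/asboolP; rewrite /sqnorm esum1 ?ltry// => i _.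
  by rewrite ComplexField.Normc.normc0 expr0n.
have {}fS : a *: f \in square_summable.
  apply: (square_summable_le (M := normc a ^+ 2)) fS => i.
  by rewrite ComplexField.Normc.normcM exprMn.
move/asboolP: fS => fS; move/asboolP: gS => gS.
have hS : (\esum_(i in [set: I])
    ((normc ((a *: f) i) ^+ 2)%:E + (normc (g i) ^+ 2)%:E) < +oo)%E.
  by rewrite esumD ?lte_add_pinfty// => i _; rewrite lee_fin sqr_ge0.
pose h i : R[i] := (Num.sqrt (normc ((a *: f) i) ^+ 2 + normc (g i) ^+ 2))%:C%C.
have hE i : normc (h i) ^+ 2 = normc ((a *: f) i) ^+ 2 + normc (g i) ^+ 2.
  by rewrite /h /= expr0n addr0 !sqr_sqrtr ?sqr_ge0// addr_ge0// sqr_ge0.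
apply: (square_summable_le (M := 2) (g := h)) => [i|].
  by rewrite hE mulrDr normcD_sqr_le.
by apply/asboolP; rewrite /sqnorm; under eq_esum do rewrite hE EFinD.
Qed.

HB.instance Definition _ :=
  GRing.isSubmodClosed.Build R[i] (I -> R[i]) square_summable
    square_summable_submod.

Record ell2 := Ell2 { ell2_fun :> I -> R[i]; _ : ell2_fun \in square_summable }.

HB.instance Definition _ := [isSub for ell2_fun].
HB.instance Definition _ := [Choice of ell2 by <:].
HB.instance Definition _ := [SubChoice_isSubLmodule of ell2 by <:].

Definition ell2norm (xi : ell2) : R := Num.sqrt (fine (sqnorm xi)).

(* Sum of an absolutely summable real family. *)
Definition rsum (f : I -> R) : R :=
  fine (\esum_(i in [set: I]) ((EFin \o f)^\+ i)
        - \esum_(i in [set: I]) ((EFin \o f)^\- i))%E.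

Definition dotp (xi eta : ell2) : R[i] :=
  (rsum (fun i => complex.Re (xi i * (eta i)^*%C))
   +i* rsum (fun i => complex.Im (xi i * (eta i)^*%C)))%C.

Implicit Types (T S : ell2 -> ell2) (A J : set (ell2 -> ell2)).

Definition bounded_operator T : Prop :=
  linear T /\ exists M : R, forall xi, ell2norm (T xi) <= M * ell2norm xi.

(* The supremum is over a bounded set only if T is a bounded operator. *)
Definition opnorm T : R :=
  sup [set ell2norm (T xi) | xi in [set xi | ell2norm xi <= 1]].

(* S is T^*; a bounded operator T has exactly one adjoint. *)
Definition adjoint_of T S : Prop :=
  forall xi eta, dotp (T xi) eta = dotp xi (S eta).

Definition norm_closed A : Prop :=
  forall T, bounded_operator T ->
    (forall e : R, 0 < e -> exists2 S, A S & opnorm (T - S) < e) -> A T.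

Record cstar_subalgebra A : Prop := {
  cstar_bounded : A `<=` bounded_operator;
  cstar_zero : A 0;
  cstar_add : forall T S, A T -> A S -> A (T + S);
  cstar_scale : forall (c : R[i]) T, A T -> A (c *: T);
  cstar_mul : forall T S, A T -> A S -> A (T \o S);
  cstar_adjoint : forall T S, A T -> bounded_operator S -> adjoint_of T S -> A S;
  cstar_closed : norm_closed A
}.

Definition cstar_generated (X : set (ell2 -> ell2)) : set (ell2 -> ell2) :=
  \bigcap_(A in [set A | cstar_subalgebra A /\ X `<=` A]) A.

Record closed_ideal A J : Prop := {
  ideal_sub : J `<=` A;
  ideal_zero : J 0;
  ideal_add : forall T S, J T -> J S -> J (T + S);
  ideal_scale : forall (c : R[i]) T, J T -> J (c *: T);
  ideal_mull : forall T S, A T -> J S -> J (T \o S);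
  ideal_mulr : forall T S, J T -> A S -> J (T \o S);
  ideal_closed : norm_closed J
}.

Definition simple_cstar A : Prop :=
  A <> [set 0] /\ forall J, closed_ideal A J -> J = [set 0] \/ J = A.

End Ell2.

Record two_cocycle (R : realType) (G : groupType) := TwoCocycle {
  cocycle_fun :> G -> G -> R[i];
  cocycle_unimodular : forall g h, `|cocycle_fun g h| = 1;
  cocycle_mul : forall g h k,
    cocycle_fun g h * cocycle_fun (g * h)%g k =
    cocycle_fun g (h * k)%g * cocycle_fun h k;
  cocycle_1r : forall g, cocycle_fun g 1%g = 1;
  cocycle_1l : forall g, cocycle_fun 1%g g = 1
}.

Definition trivial_cocycle (R : realType) (G : groupType) : two_cocycle R G :=
  @TwoCocycle R G (fun _ _ => 1) (fun _ _ => normr1 _) (fun _ _ _ => erefl)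
    (fun _ => erefl) (fun _ => erefl).

Section TwistedGroupAlgebra.
Variables (R : realType) (G : groupType) (sigma : two_cocycle R G).

Local Notation normc := ComplexField.Normc.normc.

Definition lambda_fun (g : G) (xi : G -> R[i]) : G -> R[i] :=
  fun h => sigma g (g^-1 * h)%g * xi (g^-1 * h)%g.

Lemma lambda_square_summable g (xi : ell2 R G) :
  lambda_fun g xi \in @square_summable R G.
Proof.
case: xi => xi /= /asboolP xiS; apply/asboolP; rewrite /sqnorm.
have normcE (x y : R[i]) : `|x| = 1 -> normc (x * y) = normc y.
  move=> x1; rewrite ComplexField.Normc.normcM.
  suff -> : normc x = 1 by rewrite mul1r.
  by case: x1.
under eq_esum do rewrite /lambda_fun normcE ?cocycle_unimodular//.
have gB : set_bij [set: G] [set: G] (fun h => (g^-1 * h)%g).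
  split=> [//|h k _ _ /mulgI//|h _].
  by exists (g * h)%g => //; rewrite mulKg.
by rewrite -(reindex_esum _ _ _ (fun h => (normc (xi h) ^+ 2)%:E) gB).
Qed.

Definition lambda (g : G) (xi : ell2 R G) : ell2 R G :=
  Ell2 (lambda_square_summable g xi).

(* The reduced twisted C*-algebra of a subgroup H of G, realized on the Hilbert
   space of G; C*_r(G, sigma) is the case H = G. *)
Definition reduced_cstar (H : {pred G}) : set (ell2 R G -> ell2 R G) :=
  cstar_generated [set lambda h | h in [set` H]].

Definition cstar_irreducible (H : {pred G}) : Prop :=
  forall C : set (ell2 R G -> ell2 R G), cstar_subalgebra C ->
    reduced_cstar H `<=` C -> C `<=` reduced_cstar predT -> simple_cstar C.

End TwistedGroupAlgebra.

(* Main.v *)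
(* Powers' averaging argument, relative to [H].  Removing an edge cuts the tree
   into two half-trees.  Since the action is minimal and of general type, any
   half-tree can be moved inside any other one; strong faithfulness then shows
   that no nontrivial element fixes a half-tree pointwise, and hence that every
   finite set of nontrivial elements moves some half-tree [U] off itself.
   A commutator of a nontrivial element of [H] with an element of [G] is a
   contraction in [H], whose powers provide infinitely many elements [h_i] of
   [H] with pairwise disjoint [h_i (~` U)].

   On the operator side this gives [|1/n sum_i lambda (h_i f h_i^-1)| <=
   2 / sqrt n] for all [f] in the finite set, whatever the cocycle.  A nonzero
   closed ideal [J] of an intermediate algebra contains some [x^* x] of trace
   [1]; averaging it over the [h_i] stays in [J] and comes within distance [< 1]
   of the identity, so that [J] contains the identity. *)

Require Import Defs.
From mathcomp Require Import all_boot all_order all_algebra.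
From mathcomp Require Import reals.
From mathcomp Require Import boolp classical_sets functions cardinality fsbigop.
From mathcomp Require Import ereal esum numfun.
From mathcomp Require Import complex.
From mathcomp Require Import zify ring lra.

Set Implicit Arguments.
Unset Strict Implicit.
Unset Printing Implicit Defensive.

Local Open Scope classical_set_scope.

(** * Half-trees *)

(** The boundary of the tree never receives a topology: half-trees stand in for its basic open sets,
    and the operator side sees the tree only through one subset of [G], the pullback of a half-tree
    along an orbit map.

    Passing from an element that fixes no half-tree pointwise to a half-tree moved off itself rests
    on branching. Two points cannot meet three disjoint half-trees at a vertex [v], so an [f] under
    which all small half-trees meet their image fixes all nearby translates of [v], hence the paths
    between them.

    The reduced algebra is an intersection of algebras, so its elements are studied inside an
    explicit algebra containing it, the norm closure of finite combinations of the [lambda g]. The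
    trace is the entry [T (delta 1) 1]; it is faithful because elements of that closure commute with
    twisted right translations. A cocycle changes conjugates of [lambda f] only by unimodular
    scalars, to which the estimate is blind. Averages have [(k + 1)^2] terms so that [2 / sqrt n] is
    [2 / (k + 1)]; the distance to the identity is kept at [3/4], the sum of three errors [1/4]. *)

Section HalfTrees.
Variables (V : eqType) (adj : rel V).
Hypothesis treeV : is_tree adj.

Let adjC : symmetric adj. Proof. by case: treeV. Qed.

(** Only the cut is recorded: the one edge leaving [U] goes from [y] to [x]. In a tree this
    determines [U] ([halftree_uniq]), and it passes to complements and translates without any
    argument on paths. *)
Definition halftree (x y : V) (U : set V) : Prop :=
  [/\ adj x y, U y, ~ U x &
      forall a b, adj a b -> U a -> ~ U b -> a = y /\ b = x].

Definition half (x y : V) : set V :=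
  [set z | exists p, [/\ path adj y p, last y p = z & x \notin y :: p]].

Lemma ex_upath x y : exists p, [/\ path adj x p, last x p = y & uniq (x :: p)].
Proof.
case: treeV => _ _ _ conn _; have [p xp yp] := conn x y.
by case/shortenP: xp yp => q xq uq _ yq; exists q.
Qed.

Lemma halftree_half x y : adj x y -> halftree x y (half x y).
Proof.
case: treeV => _ _ irr _ acyc xy.
have nxy : x != y by apply: contraTneq xy => ->; rewrite irr.
split=> //.
- by exists [::]; rewrite inE.
- by case=> p [_ lp]; rewrite -lp mem_last.
move=> a b ab [p [yp lp xp]] nb.
have bx : b = x.
  apply: contrapT => /eqP bx; apply: nb; exists (rcons p b); split.
  - by rewrite rcons_path yp lp.
  - by rewrite last_rcons.
  - by rewrite -rcons_cons mem_rcons inE negb_or eq_sym bx.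
split=> //; rewrite {}bx in ab nb *.
apply: contrapT => ay; case/shortenP: yp lp xp => q yq uq sq lq xp.
(* A path from [y] to some [a] other than [y] that avoids [x] closes up to a cycle through [x]. *)
apply: (acyc [:: x, y & q]).
  by case: q lq {yq uq sq} => [/= ya|//]; case: ay.
apply/andP; split; first by rewrite /= xy rcons_path yq lq.
rewrite cons_uniq uq andbT; apply: contra xp.
by rewrite !inE => /orP[->//|/sq ->]; rewrite orbT.
Qed.

Lemma halftreeC x y U : halftree x y U -> halftree y x (~` U).
Proof.
case=> xy Uy nUx cr; split=> //; first by rewrite adjC.
by move=> a b ab nUa /contrapT Ub; rewrite adjC in ab; have [] := cr _ _ ab Ub nUa.
Qed.

Lemma halftree_cross x y U a p : halftree x y U -> path adj a p -> U a ->
  ~ U (last a p) -> exists p1 p2, a :: p = p1 ++ [:: y, x & p2].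
Proof.
case=> _ _ _ cr; elim: p a => [|b p IH] a //= /andP[ab bp] Ua nl.
have [Ub|nUb] := pselect (U b).
  by have [p1 [p2 ->]] := IH _ bp Ub nl; exists (a :: p1), p2.
by have [-> ->] := cr _ _ ab Ua nUb; exists [::], p.
Qed.

(** A path that leaves [U] and comes back crosses the cut edge twice, so it visits [y] twice. *)
Lemma halftree_convex x y U a p : halftree x y U -> path adj a p ->
  uniq (a :: p) -> U a -> U (last a p) -> forall z, z \in p -> U z.
Proof.
move=> ht ap up Ua Ul z zp; apply: contrapT => nz.
case/splitPr: zp ap up Ul => p1 p2.
rewrite cat_path last_cat => /andP[ap1 /andP[lz zp2]] up Ul.
have [q1 [q2 E1]] : exists q1 q2, a :: rcons p1 z = q1 ++ [:: y, x & q2].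
  by apply: (halftree_cross ht) => //; rewrite ?rcons_path ?ap1// last_rcons.
have [q3 [q4 E2]] : exists q1 q2, z :: p2 = q1 ++ [:: x, y & q2].
  by apply: (halftree_cross (halftreeC ht)) => //; apply.
have yz : y != z by apply: contra_not_neq nz => <-; case: ht.
have y1 : y \in a :: p1.
  have : y \in a :: rcons p1 z by rewrite E1 mem_cat !inE eqxx orbT.
  by rewrite -rcons_cons mem_rcons inE (negPf yz).
have y2 : y \in z :: p2 by rewrite E2 mem_cat !inE eqxx !orbT.
by move: up; rewrite -cat_cons cat_uniq => /and3P[_ /hasPn/(_ _ y2)]; rewrite /= y1.
Qed.

(* If [x] were outside [S] but [S] stuck out of [U], a path inside [S] would
   have to leave [U] through [x]. *)
Lemma halftree_sub x y U x' y' S z : halftree x y U -> halftree x' y' S ->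
  ~ S x -> U z -> S z -> S `<=` U.
Proof.
move=> hU hS nSx Uz Sz w Sw; apply: contrapT => nUw; apply: nSx.
have [p [zp lp up]] := ex_upath z w.
have Sp := halftree_convex hS zp up Sz; rewrite lp in Sp.
have [|p1 [p2 E]] := halftree_cross hU zp Uz; first by rewrite lp.
have : x \in z :: p by rewrite E mem_cat !inE eqxx !orbT.
by rewrite inE => /predU1P[->|/(Sp Sw)].
Qed.

(** A simple path starting with [a], [b] ends in [half a b]; one starting with [a], [c], where [c]
    lies outside this half-tree, could enter it only by returning to [a]. *)
Lemma upath_inj a p q : path adj a p -> uniq (a :: p) -> path adj a q ->
  uniq (a :: q) -> last a p = last a q -> p = q.
Proof.
elim: p a q => [|b p IH] a [|c q] //.
- by move=> _ _ _ /= /andP[/negP nq _] E; case: nq; rewrite E mem_last.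
- by move=> _ /= /andP[/negP nq _] _ _ E; case: nq; rewrite -E mem_last.
move=> /= /andP[ab bp] /andP[abp ubp] /andP[ac cq] /andP[acq ucq] E.
have ht := halftree_half ab; have [_ Ub nUa cr] := ht.
have Ul : half a b (last b p).
  apply: contrapT => /(halftree_cross ht bp Ub)[p1 [p2 Ep]].
  by move: abp; rewrite Ep mem_cat !inE eqxx !orbT.
have bc : b = c.
  have [Uc|nUc] := pselect (half a b c).
    by have [] := cr c a _ Uc nUa; rewrite // adjC.
  have [|p1 [p2 Ep]] := halftree_cross (halftreeC ht) cq nUc.
    by rewrite -E; apply.
  by move: acq; rewrite Ep mem_cat !inE eqxx !orbT.
by subst c; rewrite (IH b q).
Qed.

(** The image of the path is a simple path with the same ends, hence the same path. *)
Lemma fixed_convex f a p : {mono f : x y / adj x y} -> injective f ->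
  path adj a p -> uniq (a :: p) -> f a = a -> f (last a p) = last a p ->
  forall z, z \in p -> f z = z.
Proof.
move=> fM fI ap up fa fl.
have E : [seq f i | i <- p] = p.
  apply: (upath_inj (a := a)) => //.
  - by rewrite -[in X in path _ X]fa path_map; under eq_path do rewrite /= fM.
  - by rewrite -[in X in X :: _]fa -map_cons map_inj_uniq.
  - by rewrite -[in X in last X _]fa last_map.
by apply/eq_in_map; rewrite E map_id.
Qed.


Lemma halftree_uniq x y U S : halftree x y U -> halftree x y S -> U = S.
Proof.
move=> hU hS; case: (hU) (hS) => _ Uy nUx _ [_ Sy nSx _].
by apply/seteqP; split; [exact: (halftree_sub hS hU nUx Sy Uy)|
                         exact: (halftree_sub hU hS nSx Uy Sy)].
Qed.

(** Source of the invariant subtrees to which minimality is applied. *)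
Lemma subtree_halftrees (x0 : V) (P : set V -> Prop) :
  (forall U, P U -> (exists x y, halftree x y U) /\ U x0) ->
  subtree adj [set z | forall U, P U -> U z].
Proof.
move=> PU; split; first by exists x0 => U /PU[].
move=> x y Sx Sy; have [p [xp lp up]] := ex_upath x y.
exists p; split=> // z zp U PU'; have [[a [b hU]] _] := PU _ PU'.
by apply: (halftree_convex hU xp up _ _ zp); [exact: Sx|rewrite lp; exact: Sy].
Qed.

(** * Rays and the nested half-trees along them *)

Section Rays.
Variable r : nat -> V.
Hypothesis rayr : ray adj r.

Lemma ray_halftree n : halftree (r n) (r n.+1) (half (r n) (r n.+1)).
Proof. by apply: halftree_half; case: rayr. Qed.

Lemma ray_half n m : (n < m)%N -> half (r n) (r n.+1) (r m).
Proof.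
have [_ Uy nUx cr] := ray_halftree n; case: rayr => ra rI.
elim: m => // m IH; rewrite ltnS leq_eqVlt => /predU1P[<-//|nm].
apply: contrapT => nU; have [_ /rI mn] := cr _ _ (ra m) (IH nm) nU.
by rewrite -mn ltnNge leqnSn in nm.
Qed.

Lemma ray_nhalf n m : (m <= n)%N -> ~ half (r n) (r n.+1) (r m).
Proof.
have [_ Uy nUx cr] := ray_halftree n; case: rayr => ra rI.
move=> mn; rewrite -(subKn mn); elim: (n - m)%N (leq_subr m n) => [|k IH] kn.
  by rewrite subn0.
move=> Ui; have := IH (ltnW kn); rewrite -(subnSK kn) => nU.
have [/rI E _] := cr _ _ (ra _) Ui nU.
by have := leq_subr k.+1 n; rewrite E ltnn.
Qed.

Lemma ray_half_sub n m : (n <= m)%N ->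
  half (r m) (r m.+1) `<=` half (r n) (r n.+1).
Proof.
move=> nm; apply: (halftree_sub (ray_halftree n) (ray_halftree m)).
- exact: ray_nhalf.
- exact: (@ray_half _ m.+1).
- exact: ray_half.
Qed.

(** If [z] lay in all these half-trees, the path from [r 0] to [z] would pass through every [r i],
    which is more vertices than it has. *)
Lemma ray_escape z : exists n, forall m, (n <= m)%N -> ~ half (r m) (r m.+1) z.
Proof.
suff [n nz] : exists n, ~ half (r n) (r n.+1) z.
  by exists n => m /ray_half_sub sub /sub.
apply: contrapT => /forallNP h; have {}h n := contrapT (h n).
have [p [rp lp _]] := ex_upath (r 0) z.
have sub : {subset [seq r i | i <- iota 0 (size p).+2] <= r 0 :: p}.
  move=> _ /mapP[i _ ->].
  have hC := halftreeC (ray_halftree i).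
  have [|q1 [q2 ->]] := halftree_cross hC rp (ray_nhalf (leq0n _)).
    by rewrite lp; apply.
  by rewrite mem_cat !inE eqxx orbT.
have := uniq_leq_size _ sub; rewrite map_inj_uniq ?iota_uniq; last by case: rayr.
by rewrite size_map size_iota /= ltnn => /(_ isT).
Qed.

End Rays.

(** If the half-trees met at every stage, [s] would enter each far [half (r m) (r m.+1)],
    necessarily along the edge from [r m] to [r m.+1]. Injectivity of [s] makes these crossings
    consecutive, so [s] eventually follows [r]. *)
Lemma noncofinal_disjoint r s : ray adj r -> ray adj s -> ~ cofinal r s ->
  exists k, forall m, (k <= m)%N ->
    half (r m) (r m.+1) `&` half (s m) (s m.+1) = set0.
Proof.
move=> rayr rays ncof.
suff [k E] : exists k, half (r k) (r k.+1) `&` half (s k) (s k.+1) = set0.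
  exists k => m km; apply/seteqP; split=> // z [rz sz]; rewrite -E.
  by split; [exact: (ray_half_sub rayr km)|exact: (ray_half_sub rays km)].
apply: contrapT => /forallNP ne; apply: ncof.
have {}ne k : exists2 z, half (r k) (r k.+1) z & half (s k) (s k.+1) z.
  by have /eqP/set0P[z [? ?]] := ne k; exists z.
have [n nP] := ray_escape rayr (s 0).
have key m : (n <= m)%N -> exists j, s j = r m /\ s j.+1 = r m.+1.
  move=> nm; have [_ Uy nUx cr] := ray_halftree rayr m.
  have [k Uk] : exists k, half (r m) (r m.+1) (s k).
    have [k kP] := ray_escape rays (r m).
    have [z rz sz] := ne (maxn k m).
    exists (maxn k m).+1.
    have nsr := kP _ (leq_maxl k m).
    have rz' := ray_half_sub rayr (leq_maxr k m) rz.
    apply: (halftree_sub (ray_halftree rayr m) (ray_halftree rays _) nsr rz' sz).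
    exact: ray_half.
  have /= := nP _ nm; elim: k Uk => // k IH Uk ns0.
  have [Uk'|nUk] := pselect (half (r m) (r m.+1) (s k)); first exact: IH.
  have skk : adj (s k.+1) (s k) by rewrite adjC; case: rays.
  by have [? ?] := cr _ _ skk Uk nUk; exists k.
have [j [sj _]] := key n (leqnn n).
exists n, j => k; elim: k => [|k IH]; first by rewrite !addn0.
have [i [si si1]] := key (n + k)%N (leq_addr _ _).
case: rays => _ sI; move: si; rewrite IH => /sI ij.
by rewrite !addnS -si1 ij.
Qed.


(** To leave [half (r i) (r i.+1)] the walk would have to be at [r i.+1] again, but by induction it
    is still in [half (r i.+1) (r i.+2)], which excludes that vertex. *)
Lemma nonbacktracking_ray r : (forall n, adj (r n) (r n.+1)) ->
  (forall n, r n <> r n.+2) -> ray adj r.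
Proof.
move=> ra rnb; have ht i := halftree_half (ra i).
have key k : forall i, half (r i) (r i.+1) (r (i + k.+1)%N).
  elim/ltn_ind: k => -[|k] IH i; first by rewrite addn1; case: (ht i).
  have [_ _ _ cr] := ht i; apply: contrapT; rewrite addnS => nU.
  have [E1 E2] := cr _ _ (ra _) (IH k (ltnSn k) i) nU.
  case: k IH nU E1 E2 => [|k] IH _ E1 E2.
    by apply: (rnb i); rewrite -E2 addn1.
  have := IH k _ i.+1; rewrite addSnnS E1.
  by case: (ht i.+1) => _ _ nU _ h; apply: nU; apply: h; rewrite leqW.
split=> // i j E; apply: contrapT => /eqP; rewrite neq_ltn.
wlog ij : i j E / (i < j)%N => [W /orP[] h|_].
- by apply: (W i j) => //; rewrite h.
- by apply: (W j i) => //; rewrite h.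
have := key (j - i.+1)%N i; rewrite addnS -addSn subnKC// -E.
by case: (ht i).
Qed.

End HalfTrees.

(** * Hyperbolic automorphisms and their axes *)

Section Action.
Variables (V : eqType) (adj : rel V) (G : groupType) (act : G -> V -> V).
Hypothesis treeV : is_tree adj.
Hypothesis actV : tree_action adj act.

Lemma act1 x : act 1%g x = x. Proof. by case: actV. Qed.
Lemma actM g h x : act (g * h)%g x = act g (act h x). Proof. by case: actV. Qed.
Lemma act_adj g x y : adj (act g x) (act g y) = adj x y.
Proof. by case: actV. Qed.
Lemma actK g x : act g^-1%g (act g x) = x.
Proof. by rewrite -actM mulVg act1. Qed.
Lemma actVK g x : act g (act g^-1%g x) = x.
Proof. by rewrite -actM mulgV act1. Qed.
Lemma act_inj g : injective (act g). Proof. exact: can_inj (actK g). Qed.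

(* The translates of a shortest path among those from some [x] to [act a x]
   concatenate without backtracking. *)
Lemma hyperbolic_ray a : hyperbolic adj (act a) -> exists r l,
  [/\ (0 < l)%N, ray adj r & forall n, act a (r n) = r (n + l)%N].
Proof.
move=> [nell ninv].
pose P n := `[< exists x p, [/\ path adj x p, last x p = act a x & size p = n] >].
have exP : exists n, P n.
  case: (treeV) => -[x _] _ _ conn _; have [p xp lp] := conn x (act a x).
  by exists (size p); apply/asboolP; exists x, p.
case: (ex_minnP exP) => l /asboolP[x [p0 [xp0 lp0 sp0]]] lmin.
have [p [xp lp up sp]] : exists p,
    [/\ path adj x p, last x p = act a x, uniq (x :: p) & size p = l].
  case/shortenP: xp0 lp0 => p xp up sub lp; exists p; split=> //.
  apply/eqP; rewrite eqn_leq; apply/andP; split.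
    by rewrite -sp0; case/andP: up => _ up; apply: uniq_leq_size.
  by apply: lmin; apply/asboolP; exists x, p.
have l0 : (0 < l)%N.
  by case: p lp sp {xp up} => [/= E|b p _ <-//]; case: nell; exists x.
pose c i := nth x (x :: p) i.
have cl : c l = act a x by rewrite -lp /c -sp -[size p]/((size (x :: p)).-1) nth_last.
have ca i : (i < l)%N -> adj (c i) (c i.+1).
  by rewrite -sp => il; move/pathP: xp => /(_ x i il).
pose r n := act (a ^+ (n %/ l))%g (c (n %% l)).
have rE q i : (i <= l)%N -> r (q * l + i)%N = act (a ^+ q)%g (c i).
  rewrite leq_eqVlt /r => /predU1P[->|il].
    by rewrite -mulSnr mulnK// modnMl cl /c /= expgSr actM.
  by rewrite divnMDl// divn_small// addn0 modnMDl modn_small.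
exists r, l; split=> //; last first.
  by move=> n; rewrite /r divnDr// divnn l0 modnDr addn1 expgS actM.
have dec n : exists q i, (i < l)%N /\ n = (q * l + i)%N.
  by exists (n %/ l), (n %% l); rewrite ltn_pmod// -divn_eq.
apply: (nonbacktracking_ray treeV) => n; have [q [i [il ->]]] := dec n.
  by rewrite -addnS !rE// 1?ltnW// act_adj ca.
rewrite -!addnS; have [il2|] := leqP i.+2 l.
  rewrite !rE//; last exact: ltnW.
  move/act_inj/eqP; rewrite /c nth_uniq//= ?sp ?ltnS//.
    by rewrite -[X in X == _]addn0 -addn2 eqn_add2l.
  exact: ltnW.
rewrite ltnS => li; have {li il} El : l = i.+1 by apply/eqP; rewrite eqn_leq li.
have -> : (q * l + i.+2 = q.+1 * l + 1)%N by rewrite El mulSnr -addnA addn1.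
rewrite !rE//; last by rewrite El.
rewrite expgSr actM => /act_inj E.
(* Backtracking at the junction of two translates means [c i = act a (c 1)]. If [l = 1], then
   [act a] swaps [x] and [act a x]; otherwise dropping both end edges leaves a path of length
   [l - 2] from [c 1] to its image, against minimality of [l]. *)
case: i El E => [|i] El E.
  apply: ninv; split=> //; exists x, (act a x).
  have cx : c 0 = x by [].
  have c1 : c 1 = act a x by rewrite -cl El.
  split=> //; first by rewrite -cx -[in X in adj _ X]c1 ca.
  by rewrite -[in LHS]c1 -E.
have [x1 [p' Ep]] : exists x1 p', p = x1 :: p'.
  by case: (p) sp => [|x1 p' _]; [rewrite El|exists x1, p'].
have [p'' Ep'] : exists p'', p' = rcons p'' (act a x).
  move: lp sp; rewrite Ep /=; case: (lastP p') => [_|q' t].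
    by rewrite El => -[].
  by rewrite last_rcons => -> _; exists q'.
have sp' : size p'' = i by move: sp; rewrite Ep Ep' /= size_rcons El => -[].
suff : P i by move/lmin; rewrite El ltnNge leqnSn.
apply/asboolP; exists x1, p''; split=> //.
  by move: xp; rewrite Ep Ep' /= rcons_path => /and3P[].
have -> : x1 = c 1 by rewrite /c Ep.
rewrite -E /c Ep Ep' /= -sp' -[in RHS]rcons_cons.
rewrite nth_rcons /= ltnS leqnn -[size p'']/((size (x1 :: p'')).-1) nth_last.
done.
Qed.


Lemma half_act g x y z : half adj (act g x) (act g y) (act g z) <-> half adj x y z.
Proof.
suff h k a b c : half adj a b c -> half adj (act k a) (act k b) (act k c).
  by split=> [/(h g^-1%g)|/h//]; rewrite !actK.
case=> p [bp lp ap]; exists (map (act k) p); split.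
- by rewrite path_map; under eq_path do rewrite /= act_adj.
- by rewrite last_map lp.
- by rewrite -map_cons mem_map//; exact: act_inj.
Qed.

Definition tr g (U : set V) : set V := [set z | U (act g^-1%g z)].

Lemma halftree_tr g x y U :
  halftree adj x y U -> halftree adj (act g x) (act g y) (tr g U).
Proof.
case=> xy Uy Ux cr; split; rewrite /tr /= ?actK ?act_adj//.
move=> a b ab Ua Ub; rewrite -(act_adj g^-1%g) in ab.
by have [<- <-] := cr _ _ ab Ua Ub; rewrite !actVK.
Qed.

(* [r] and [s] are the two halves of the axis of [a], with common origin. *)
Lemma hyperbolic_axis a : hyperbolic adj (act a) -> exists r s l,
  [/\ (0 < l)%N, ray adj r /\ ray adj s,
      (forall n, act a (r n) = r (n + l)%N) /\
      (forall n, act a (s (n + l)%N) = s n),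
      s 0 = r 0 /\ act a (s l.-1) = r 1 &
      forall i j, s i = r j -> i = 0 /\ j = 0].
Proof.
move=> /hyperbolic_ray[r [l [l0 [ra rI] ar]]].
have aXr k n : act (a ^+ k)%g (r n) = r (n + k * l)%N.
  elim: k => [|k IH]; first by rewrite act1 addn0.
  by rewrite expgS actM IH ar mulSnr addnA.
(* The point at position [-n] of the axis, obtained by moving position [n * (l - 1)] back by
   [n * l]. *)
pose s n := act (a ^+ n)^-1%g (r (n * l.-1)%N).
have sN N n : (n <= N)%N -> act (a ^+ N)%g (s n) = r (N * l - n)%N.
  move=> /subnK <-; set k := (N - n)%N.
  rewrite expgnDr actM actVK aXr; congr r.
  by have := l0; case: (l) => // m _ /=; lia.
have lN N : (N <= N * l)%N by rewrite leq_pmulr.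
exists r, s, l; split=> //; last first.
- move=> i j E; have := sN i i (leqnn i); rewrite E aXr => /rI.
  have := lN i; lia.
- split; first by rewrite -[LHS]act1 (sN 0).
  apply: (@act_inj (a ^+ l.-1)%g); rewrite -actM -expgSr prednK// sN ?leq_pred//.
  rewrite aXr; congr r; have := l0; case: (l) => // m _ /=.
  by lia.
- split=> // n; apply: (@act_inj (a ^+ (n + l))%g).
  rewrite -actM -expgSr expgS actM !sN ?leq_addr// ar; congr r.
  by have := lN (n + l)%N; lia.
split=> //; split=> [n|i j E].
  rewrite -(act_adj (a ^+ n.+1)%g) !sN//.
  case: (treeV) => _ -> _ _ _; rewrite -(@subnSK n (n.+1 * l)) ?lN//.
have := sN (maxn i j) _ (leq_maxl i j); rewrite E sN ?leq_maxr// => /rI.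
have := lN (maxn i j); have := leq_maxl i j; have := leq_maxr i j; lia.
Qed.

(** A ray cofinal with both of its images would have as its class a boundary point fixed by [a] and
    [b]. *)
Lemma transverse_noncofinal a b r : transverse adj (act a) (act b) ->
  ray adj r -> cofinal r (act a \o r) -> ~ cofinal r (act b \o r).
Proof.
move=> tab rayr.
have cT (u v w : nat -> V) : cofinal u v -> cofinal v w -> cofinal u w.
  move=> [m [n uv]] [m' [n' vw]]; exists (m + m')%N, (n' + n)%N => k.
  by rewrite -addnA uv addnCA vw addnA.
have cC (u v : nat -> V) : cofinal u v -> cofinal v u.
  by move=> [m [n uv]]; exists n, m => k; rewrite uv.
have cA g u v : cofinal u v -> cofinal (act g \o u) (act g \o v).
  by move=> [m [n uv]]; exists m, n => k /=; rewrite uv.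
have rA g u : ray adj u -> ray adj (act g \o u).
  move=> [ua uI]; split=> [n|]; first by rewrite /= act_adj.
  by apply: inj_comp => //; exact: act_inj.
have fixP g : cofinal r (act g \o r) -> fixed_points adj (act g)
    (inr [set s | ray adj s /\ cofinal r s]).
  move=> rg; split; first by exists r.
  apply/seteqP; split=> [_ [s [rs rcs] <-]|s [rs rcs]] /=.
    by split; [exact: rA|exact: cT _ _ _ rg (cA _ _ _ rcs)].
  exists (act g^-1%g \o s); last by apply/funext => n /=; rewrite actVK.
  split; first exact: rA.
  have Er : r = act g^-1%g \o (act g \o r) by apply/funext => n /=; rewrite actK.
  by rewrite Er; apply: cA; exact: cT _ _ _ (cC _ _ rg) rcs.
move=> /fixP fa /fixP fb.
have : (fixed_points adj (act a) `&` fixed_points adj (act b))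
  (inr [set s | ray adj s /\ cofinal r s]) by split.
by rewrite tab.
Qed.

(** * Moving half-trees into one another *)

Section Minimal.
Hypothesis minV : minimal_action adj act.
Hypothesis gtV : general_type adj act.

(** If the orbit of [z] missed [U], the intersection of all half-trees containing that orbit would
    be an invariant subtree avoiding [y]. *)
Lemma halftree_orbit x y U z : halftree adj x y U -> exists g, U (act g z).
Proof.
move=> hU; apply: contrapT => /forallNP nU.
pose P W := (exists a b, halftree adj a b W) /\ forall g, W (act g z).
have PC : P (~` U).
  by split=> //; exists y, x; exact: halftreeC.
have ST : [set t | forall W, P W -> W t] = setT.
  apply: minV.
    apply: (subtree_halftrees treeV (x0 := z)) => W [hW Wz]; split=> //.
    by rewrite -[z]act1.
  move=> g t St W [[a [b hW]] Wz].
  have /St : P (tr g^-1%g W).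
    split; first by exists (act g^-1%g a), (act g^-1%g b); exact: halftree_tr.
    by move=> h; rewrite /tr /= -actM.
  by rewrite /tr /= invgK.
have : [set t | forall W, P W -> W t] y by rewrite ST.
by move=> /(_ _ PC); apply; case: hU.
Qed.

(** Push [S] far along [r], where [b] moves the half-tree off itself, and pull back: a conjugate of
    [b] moves [S] off itself. *)
Lemma ray_moved b r (S : set V) : ray adj r -> ~ cofinal r (act b \o r) ->
  (forall k, exists g, forall z, S z -> half adj (r k) (r k.+1) (act g z)) ->
  exists g, forall z, S z -> ~ S (act g z).
Proof.
move=> rayr nc Sr.
have raybr : ray adj (act b \o r).
  case: rayr => ra rI; split=> [n|]; first by rewrite /= act_adj.
  by apply: inj_comp => //; exact: act_inj.
have [k /(_ k (leqnn k)) dj] := noncofinal_disjoint treeV rayr raybr nc.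
have [g gP] := Sr k; exists (g^-1 * b * g)%g => z Sz.
rewrite -mulgA actM => /gP; rewrite actVK actM => h1.
by rewrite -[False]/(set0 (act b (act g z))) -dj; split=> //; exact/half_act/gP.
Qed.

(** Everything that is used of general type. [A] is cut off by an edge of the axis of [a]; powers of
    [a] push it towards one end and those of [a^-1] push its complement towards the other. The [W]s
    are neighbourhoods of the two ends of [a] and of one end of [b]. *)
Lemma general_type_halftrees : exists A,
  [/\ exists x y, halftree adj x y A,
      forall x y Y, halftree adj x y Y -> exists g,
        (forall z, A z -> Y (act g z)) \/ (forall z, ~ A z -> Y (act g z)),
      exists g, forall z, A z -> ~ A (act g z),
      exists g, forall z, ~ A z -> A (act g z) &
      exists W1 W2 x y W3,
        [/\ exists x y, halftree adj x y W1, exists x y, halftree adj x y W2,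
            halftree adj x y W3 &
            [/\ W1 `&` W2 = set0, W1 `&` W3 = set0 & W2 `&` W3 = set0]]].
Proof.
case: gtV => a [b [ha hb tab]].
have [r [s [l [l0 [rayr rays] [ar as_] [s0 sl1] sr]]]] := hyperbolic_axis ha.
have [t [l' [l'0 rayt bt]]] := hyperbolic_ray hb.
have rar : cofinal r (act a \o r) by exists l, 0 => k /=; rewrite ar add0n addnC.
have sas : cofinal s (act a \o s) by exists 0, l => k /=; rewrite add0n addnC as_.
have rbr := transverse_noncofinal tab rayr rar.
have sbs := transverse_noncofinal tab rays sas.
have bt' u : cofinal u t -> cofinal u (act b \o u).
  move=> [m [n ut]]; exists (m + l')%N, m => k /=.
  by rewrite -addnA !ut bt; congr t; lia.
have rt : ~ cofinal r t by move/bt'.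
have st : ~ cofinal s t by move/bt'.
set A := half adj (r 0) (r 1).
have hA : halftree adj (r 0) (r 1) A by exact: ray_halftree.
have Ar k : exists g, forall z, A z -> half adj (r k) (r k.+1) (act g z).
  exists (a ^+ k)%g => z Az.
  have aXr n : act (a ^+ k)%g (r n) = r (n + k * l)%N.
    elim: k => [|k IH]; first by rewrite act1 addn0.
    by rewrite expgS actM IH ar mulSnr addnA.
  apply: (@ray_half_sub _ _ treeV r rayr k (k * l)%N); first by rewrite leq_pmulr.
  by rewrite -[(k * l)%N]add0n -addSn -!aXr; exact/half_act.
(* The edge from [r 1] to [r 0] is the [a]-image of the edge from [s l.-1] to [s l], which makes the
   complement of [A] one of the half-trees along the axis in the direction of [s]. *)
have nAE : ~` A = half adj (act a (s l.-1)) (act a (s l)).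
  have -> : act a (s l) = r 0 by rewrite -s0 -(as_ 0).
  rewrite sl1; apply: (halftree_uniq treeV (halftreeC treeV hA)).
  by apply: halftree_half => //; case: (halftreeC treeV hA).
have As k : exists g, forall z, ~ A z -> half adj (s k) (s k.+1) (act g z).
  exists (a ^+ k.+1)^-1%g => z; rewrite -[~ A z]/((~` A) z) nAE => nAz.
  have aXs n : act (a ^+ k)%g (s (n + k * l)%N) = s n.
    elim: k n => [|k IH] n; first by rewrite act1 addn0.
    by rewrite expgSr actM mulSnr addnA as_ IH.
  apply: (@ray_half_sub _ _ treeV s rays k (l.-1 + k * l)%N).
    by rewrite (leq_trans (leq_pmulr k l0))// leq_addl.
  apply/(half_act (a ^+ k.+1)%g); rewrite actVK expgS !actM -addSn !aXs.
  by rewrite prednK.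
exists A; split.
- by exists (r 0), (r 1).
- move=> x y Y hY; have [g Yg] := halftree_orbit (r 0) hY.
  have hY' := halftree_tr g^-1%g hY; set Y' := tr _ Y in hY'.
  have Y'E z : Y' z = Y (act g z) by rewrite /Y' /tr /= invgK.
  have [_ _ nYx cr] := hY'.
  have main (u : nat -> V) : ray adj u -> (forall n, Y' (u n)) ->
      exists k, half adj (u k) (u k.+1) `<=` Y'.
    move=> rayu uY; have [k kP] := ray_escape treeV rayu (act g^-1%g x).
    exists k; apply: (halftree_sub treeV hY' (ray_halftree treeV rayu k)) (uY k.+1) _.
    + exact: kP.
    + exact: ray_half.
  have cross (u : nat -> V) : ray adj u -> Y' (u 0) -> ~ (forall n, Y' (u n)) ->
      exists n, u n.+1 = act g^-1%g x.
    move=> rayu u0 /existsNP[n]; elim: n => [//|n IH] nu.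
    have [Yu|nYu] := pselect (Y' (u n)); last exact: IH.
    by have [_ ?] := cr _ _ (rayu.1 n) Yu nu; exists n.
  have Y'r0 : Y' (r 0) by rewrite Y'E.
  have [rY|nrY] := pselect (forall n, Y' (r n)).
    have [k kP] := main _ rayr rY; have [h hP] := Ar k.
    by exists (g * h)%g; left=> z /hP/kP; rewrite Y'E actM.
  have [sY|nsY] := pselect (forall n, Y' (s n)).
    have [k kP] := main _ rays sY; have [h hP] := As k.
    by exists (g * h)%g; right=> z /hP/kP; rewrite Y'E actM.
  (* If both halves of the axis left [Y'], both would pass through its outer vertex at a positive
     index, while they share only their origin. *)
  have [i Ei] := cross _ rayr Y'r0 nrY.
  have [|j Ej] := cross _ rays _ nsY; first by rewrite s0.
  by have [] := sr j.+1 i.+1; rewrite // Ei Ej.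
- exact: ray_moved rayr rbr Ar.
- have [g gP] := ray_moved (S := ~` A) rays sbs As.
  by exists g => z /gP/contrapT.
have [k1 k1P] := noncofinal_disjoint treeV rayr rayt rt.
have [k2 k2P] := noncofinal_disjoint treeV rays rayt st.
set k := maxn k1 k2; have k1k : (k1 <= k)%N by rewrite leq_maxl.
have k2k : (k2 <= k)%N by rewrite leq_maxr.
have rs0 : half adj (r k) (r k.+1) `&` half adj (s k) (s k.+1) = set0.
  apply/seteqP; split=> // z [].
  move=> /(ray_half_sub treeV rayr (leq0n k)) rz /(ray_half_sub treeV rays (leq0n k)).
  have sr1 : s 1 <> r 1 by move=> /sr[].
  have [r01 Ar1 nAr0 crA] := hA.
  have hs := ray_halftree treeV rays 0; have [s01 _ ns0 crs] := hs.
  have adjC x y : adj x y = adj y x by case: treeV.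
  have nAs1 : (~` A) (s 1).
    move=> As1; apply: sr1; rewrite adjC in s01.
    by have [] := crA _ _ s01 As1; rewrite ?s0.
  have nsr1 : ~ half adj (s 0) (s 1) (r 1).
    move=> sr'; apply: sr1; rewrite adjC in r01.
    by have [] := crs _ _ r01 sr'; rewrite -?s0.
  move=> sz; apply: (halftree_sub treeV (halftreeC treeV hA) hs nsr1 nAs1 _ sz rz).
  by case: hs.
exists (half adj (r k) (r k.+1)), (half adj (s k) (s k.+1)), (t k), (t k.+1),
  (half adj (t k) (t k.+1)).
split; last by split; [exact: rs0|exact: k1P|exact: k2P].
- by exists (r k), (r k.+1); exact: ray_halftree.
- by exists (s k), (s k.+1); exact: ray_halftree.
- exact: ray_halftree.
Qed.

Definition is_halftree U := exists x y, halftree adj x y U.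

Lemma is_halftreeC U : is_halftree U -> is_halftree (~` U).
Proof. by move=> [x [y /(halftreeC treeV)]]; exists y, x. Qed.

Lemma is_halftree_tr g U : is_halftree U -> is_halftree (tr g U).
Proof. by move=> [x [y /(halftree_tr g)]]; exists (act g x), (act g y). Qed.

(** Each half-tree receives [A] or its complement, and [c], [d] exchange the two cases. So [A] goes
    into the complement of [X]; taking complements, [X] goes into that of [A], and from there into
    [Y]. *)
Lemma halftree_into X Y : is_halftree X -> is_halftree Y ->
  exists g, forall z, X z -> Y (act g z).
Proof.
move=> /is_halftreeC[x [y hX]] [x' [y' hY]].
have [A [_ AY [c cP] [d dP] _]] := general_type_halftrees.
have [g gP] : exists g, forall z, A z -> (~` X) (act g z).
  have [g [gP|gP]] := AY _ _ _ hX; first by exists g.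
  by exists (g * c)%g => z /cP/gP; rewrite actM.
have [h hP] : exists h, forall z, ~ A z -> Y (act h z).
  have [h [hP|hP]] := AY _ _ _ hY; last by exists h.
  by exists (h * d)%g => z /dP/hP; rewrite actM.
exists (h * g^-1)%g => z Xz; rewrite actM; apply: hP => /gP.
by rewrite actVK.
Qed.

Lemma ex_halftree : exists U, is_halftree U.
Proof. by have [A [hA _ _ _ _]] := general_type_halftrees; exists A. Qed.

(** An element taking the complement of [W3] into [U] takes the disjoint [W1] and [W2] along. *)
Lemma halftree_two U : is_halftree U -> exists X1 X2,
  [/\ is_halftree X1, is_halftree X2, X1 `<=` U, X2 `<=` U & X1 `&` X2 = set0].
Proof.
move=> hU; have [A [_ _ _ _]] := general_type_halftrees.
move=> [W1 [W2 [x [y [W3 [h1 h2 h3 [d12 d13 d23]]]]]]].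
have hW3 : is_halftree W3 by exists x, y.
have [g gP] := halftree_into (is_halftreeC hW3) hU.
have trK W z : tr g W (act g z) = W z by rewrite /tr /= actK.
have sub W : W `&` W3 = set0 -> tr g W `<=` U.
  move=> d z; rewrite -(actVK g z) trK => Wz; apply: gP => W3z.
  by rewrite -[False]/(set0 (act g^-1%g z)) -d.
exists (tr g W1), (tr g W2); split; [exact: is_halftree_tr|exact: is_halftree_tr| | |].
- exact: sub.
- exact: sub.
apply/seteqP; split=> // z [z1 z2].
by rewrite -[set0 z]/(set0 (act g^-1%g z)) -d12.
Qed.

(** Without branching, [W1], [W2] and the path joining them form a set closed under adjacency, hence
    the whole tree. But the path avoids [W3] by convexity of its complement, so nothing is left for
    [W3]. *)
Lemma ex_branch : exists v n1 n2 n3, [/\ adj v n1, adj v n2 & adj v n3] /\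
  [/\ n1 != n2, n1 != n3 & n2 != n3].
Proof.
have [A [_ _ _ _]] := general_type_halftrees.
move=> [W1 [W2 [x3 [y3 [W3 [[x1 [y1 h1]] [x2 [y2 h2]] h3 [d12 d13 d23]]]]]]].
apply: contrapT => nbr.
have val2 v a b c : adj v a -> adj v b -> adj v c -> a != b -> c = a \/ c = b.
  move=> va vb vc ab; apply: contrapT => /not_orP[/eqP ca /eqP cb].
  by apply: nbr; exists v, a, b, c; split=> //; split; rewrite // eq_sym.
have adjC x y : adj x y = adj y x by case: treeV.
have dj U W z : U `&` W = set0 -> U z -> W z -> False.
  by move=> E Uz Wz; rewrite -[False]/(set0 z) -E.
have [p [yp lp up]] := ex_upath treeV y1 y2.
have [_ W1y _ cr1] := h1; have [_ W2y _ cr2] := h2; have [_ W3y nW3x cr3] := h3.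
have x1p : x1 \in y1 :: p.
  have [|q1 [q2 ->]] := halftree_cross h1 yp W1y.
    by rewrite lp => W1y2; exact: dj _ _ _ d12 W1y2 W2y.
  by rewrite mem_cat !inE eqxx !orbT.
have x2p : x2 \in y1 :: p.
  have [||q1 [q2 ->]] := halftree_cross (halftreeC treeV h2) yp; rewrite /= ?lp.
  - by move=> W2y1; exact: dj _ _ _ d12 W1y W2y1.
  - exact.
  by rewrite mem_cat !inE eqxx !orbT.
pose S z := [\/ W1 z, W2 z | z \in y1 :: p].
have S1 a b : adj a b -> W1 a -> S b.
  move=> ab Wa; have [Wb|nWb] := pselect (W1 b); first exact: Or31.
  by have [_ ->] := cr1 _ _ ab Wa nWb; exact: Or33.
have S2 a b : adj a b -> W2 a -> S b.
  move=> ab Wa; have [Wb|nWb] := pselect (W2 b); first exact: Or32.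
  by have [_ ->] := cr2 _ _ ab Wa nWb; exact: Or33.
have Sstep a b : adj a b -> S a -> S b.
  move=> ab [Wa|Wa|ap]; [exact: S1 ab Wa|exact: S2 ab Wa|].
  have [Wa|nW1] := pselect (W1 a); first exact: S1 ab Wa.
  have [Wa|nW2] := pselect (W2 a); first exact: S2 ab Wa.
  move: ap; rewrite inE => /predU1P[E|ap]; first by rewrite E in nW1.
  have [p1 [p2 Ep]] : exists p1 p2, p = p1 ++ a :: p2.
    by case/splitPr: ap => p1 p2; exists p1, p2.
  move: yp lp up; rewrite Ep cat_path last_cat => /andP[_ /andP[la ap2]] lp up.
  case: p2 Ep lp ap2 up => [_ /= E|c p2 Ep lp /andP[ac _] up]; first by rewrite E in nW2.
  have lac : last y1 p1 != c.
    move: up; rewrite -cat_cons cat_uniq => /and3P[_ /hasPn/(_ c) h _].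
    apply: contraNneq (h _) => [<-|]; first exact: mem_last.
    by rewrite !inE eqxx orbT.
  have : S (last y1 p1).
    by apply: Or33; rewrite Ep -cat_cons mem_cat mem_last.
  have : S c.
    by apply: Or33; rewrite Ep -cat_cons mem_cat !inE eqxx !orbT.
  by rewrite adjC in la; have [->|->] := val2 _ _ _ _ la ac ab lac.
have Sall z : S z.
  have [q [yq <- _]] := ex_upath treeV y1 z.
  have : S y1 by exact: Or31.
  elim: q (y1) yq => [//|b q IH] a /= /andP[ab bq] Sa.
  by apply: IH => //; exact: Sstep ab Sa.
have [W1y3|W2y3|py3] := Sall y3.
- exact: dj _ _ _ d13 W1y3 W3y.
- exact: dj _ _ _ d23 W2y3 W3y.
have hC := halftreeC treeV h3.
have : (~` W3) y3; last by apply.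
move: py3; rewrite inE => /predU1P[->|]; first by move=> h; exact: dj _ _ _ d13 W1y h.
apply: (halftree_convex treeV hC yp up) => h; first exact: dj _ _ _ d13 W1y h.
by rewrite lp in h; exact: dj _ _ _ d23 W2y h.
Qed.

Lemma half_disjoint v a b : adj v a -> adj v b -> a != b ->
  half adj v a `&` half adj v b = set0.
Proof.
move=> va vb /eqP ab; apply/seteqP; split=> // z [za zb]; apply: ab.
have ha := halftree_half treeV va; have hb := halftree_half treeV vb.
have [_ _ nav cra] := ha; have [_ bb nbv _] := hb.
have ab := halftree_sub treeV ha hb nbv za zb.
have bv : adj b v by case: treeV => _ -> _ _ _.
by have [] := cra b v bv (ab _ bb) nav.
Qed.

(* If [act f v] lay outside [W] and [v] outside the image of [W], then [W] and
   its image, which meet, would each contain the other, and [f] would fix [v]. *)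
Lemma fixed_or_in f v n z : adj v n -> act f v <> v ->
  half adj v n z -> half adj v n (act f z) ->
  half adj v n (act f v) \/ half adj v n (act f^-1%g v).
Proof.
move=> vn nf Wz Wfz; apply: contrapT => /not_orP[nW1 nW2].
have hW := halftree_half treeV vn; have hfW := halftree_tr f hW.
have fWz : tr f (half adj v n) (act f z) by rewrite /tr /= actK.
have s1 := halftree_sub treeV hW hfW nW2 Wfz fWz.
have s2 := halftree_sub treeV hfW hW nW1 fWz Wfz.
have E : half adj v n = tr f (half adj v n) by apply/seteqP; split.
have [_ Wn nWv _] := hW; have [_ _ _ cr] := hfW.
have nv : adj n v by case: treeV => _ -> _ _ _.
by have [_] := cr n v nv (s2 _ Wn) nW2; exact/nesym.
Qed.

(** Pigeonhole: if [v] moved, each of three disjoint half-trees would contain one of the two points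
    [act f v] and [act f^-1 v]. *)
Lemma branch_fixed f v (n1 n2 n3 : V) :
  [/\ adj v n1, adj v n2 & adj v n3] -> [/\ n1 != n2, n1 != n3 & n2 != n3] ->
  (forall n, n \in [:: n1; n2; n3] ->
     exists2 z, half adj v n z & half adj v n (act f z)) -> act f v = v.
Proof.
move=> [a1 a2 a3] [d12 d13 d23] mv; apply: contrapT => nf.
have D a b z : adj v a -> adj v b -> a != b -> half adj v a z -> ~ half adj v b z.
  by move=> va vb ab ha hb; rewrite -[False]/(set0 z) -(half_disjoint va vb ab).
have key n : adj v n -> n \in [:: n1; n2; n3] ->
    half adj v n (act f v) \/ half adj v n (act f^-1%g v).
  by move=> vn /mv[z]; exact: fixed_or_in.
have [] := key n1 a1; rewrite ?inE ?eqxx ?orbT//;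
  have [] := key n2 a2; rewrite ?inE ?eqxx ?orbT//;
  have [] := key n3 a3; rewrite ?inE ?eqxx ?orbT//.
- by move=> k3 k2 k1; exact: (D _ _ _ a1 a2 d12 k1 k2).
- by move=> k3 k2 k1; exact: (D _ _ _ a1 a2 d12 k1 k2).
- by move=> k3 k2 k1; exact: (D _ _ _ a1 a3 d13 k1 k3).
- by move=> k3 k2 k1; exact: (D _ _ _ a2 a3 d23 k2 k3).
- by move=> k3 k2 k1; exact: (D _ _ _ a2 a3 d23 k2 k3).
- by move=> k3 k2 k1; exact: (D _ _ _ a1 a3 d13 k1 k3).
- by move=> k3 k2 k1; exact: (D _ _ _ a1 a2 d12 k1 k2).
- by move=> k3 k2 k1; exact: (D _ _ _ a1 a2 d12 k1 k2).
Qed.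

(** * Half-trees moved off themselves by finitely many elements *)

Section Faithful.
Hypothesis sfV : strongly_faithful act.

(* Otherwise [f] and a conjugate of [f] fixing the complement of [U] leave no
   vertex that both move. *)
Lemma halftree_not_fixed f U : f <> 1%g -> is_halftree U ->
  ~ (forall z, U z -> act f z = z).
Proof.
move=> f1 hU fU; have [g gP] := halftree_into (is_halftreeC hU) hU.
have [||x xP] := sfV (F := [set f; (g^-1 * (f * g))%g]).
- exact: finite_set2.
- case=> [/esym//|/esym/(congr1 (fun t => g * t * g^-1)%g)].
  by rewrite mulg1 mulgV !mulgA mulgV mul1g -mulgA mulgV mulg1.
have [Ux|nUx] := pselect (U x); first by apply: (xP f); [left | exact: fU].
apply: (xP (g^-1 * (f * g))%g); first by right.
by rewrite !actM fU ?actK//; exact: gP.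
Qed.

(** If every half-tree inside [U] met its image, [f] would fix all translates in [X1] of a branch
    vertex [v], and therefore a whole half-tree [Z] inside [X1], whose vertices lie on paths between
    such translates. The second piece [X2] takes care of the branch pointing out of [X1]. *)
Lemma halftree_moved f U : f <> 1%g -> is_halftree U -> exists U',
  [/\ is_halftree U', U' `<=` U & forall z, U' z -> ~ U' (act f z)].
Proof.
move=> f1 hU; apply: contrapT => nex.
have mv U' : is_halftree U' -> U' `<=` U -> exists2 z, U' z & U' (act f z).
  move=> hU' sub; apply: contrapT => nz; apply: nex; exists U'; split=> //.
  by move=> z z1 z2; apply: nz; exists z.
have [X1 [X2 [[x1 [y1 hX1]] hX2 X1U X2U d12]]] := halftree_two hU.
have [_ X1y nX1x cr1] := hX1.
have [v [n1 [n2 [n3 [[a1 a2 a3] [e12 e13 e23]]]]]] := ex_branch.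
have subX1 y n : X1 y -> adj y n -> ~ half adj y n x1 -> half adj y n `<=` X1.
  move=> Xy yn nx; have hW := halftree_half treeV yn.
  have Xn : X1 n.
    apply: contrapT => nXn; have [_ E] := cr1 _ _ yn Xy nXn.
    by apply: nx; rewrite -E; case: hW.
  by apply: (halftree_sub treeV hX1 hW nx Xn); case: hW.
have fixv g : X1 (act g v) -> act f (act g v) = act g v.
  move=> Xy; set y := act g v in Xy *.
  apply: (@branch_fixed f y (act g n1) (act g n2) (act g n3)).
  - by rewrite /y !act_adj.
  - by split; rewrite (inj_eq (@act_inj g)).
  move=> n nP; have yn : adj y n.
    by move: nP; rewrite !inE => /or3P[] /eqP ->; rewrite act_adj.
  have hW := halftree_half treeV yn.
  (* A branch avoiding [x1] lies in [X1]. The one containing [x1] contains all that is outside [X1],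
     in particular [X2], which meets its image. *)
  have [Wx|nWx] := pselect (half adj y n x1); last first.
    by apply: mv; [exists y, n | apply: subset_trans X1U; exact: subX1].
  have [z z1 z2] := mv _ hX2 X2U.
  have sub : ~` X1 `<=` half adj y n.
    by apply: (halftree_sub treeV hW (halftreeC treeV hX1) _ Wx nX1x); apply.
  have X2C t : X2 t -> half adj y n t.
    by move=> X2t; apply: sub => X1t; rewrite -[False]/(set0 t) -d12.
  by exists z; exact: X2C.
have [g0 X0] := halftree_orbit v hX1; set y0 := act g0 v in X0.
have [n yn nWx] : exists2 n, adj y0 n & ~ half adj y0 n x1.
  apply: contrapT => nn.
  have dj := @half_disjoint y0 (act g0 n1) (act g0 n2).
  rewrite !act_adj (inj_eq (@act_inj g0)) in dj.
  rewrite -[False]/(set0 x1) -dj//; split; apply: contrapT => nx; apply: nn.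
    by exists (act g0 n1); rewrite ?act_adj.
  by exists (act g0 n2); rewrite ?act_adj.
have hZ := halftree_half treeV yn; set Z := half adj y0 n in nWx hZ.
have ZX : Z `<=` X1 by exact: subX1.
apply: (@halftree_not_fixed f Z f1); first by exists y0, n.
move=> z Zz; have [_ _ nZy _] := hZ.
have [p [yp lp up]] := ex_upath treeV y0 z.
have [q Eq] : exists q, p = rcons q z.
  case: (lastP p) lp => [/= E|q t]; first by rewrite E in nZy.
  by rewrite last_rcons => ->; exists q.
move: yp up; rewrite Eq rcons_path -rcons_cons rcons_uniq => /andP[yq qz] /andP[zq _].
(* [S] is the half-tree beyond [z] as seen from [y0]. It contains a translate of [v]; this translate
   and [y0] are fixed, and the path between them goes through [z]. *)
have hS := halftree_half treeV qz; set S := half adj _ z in hS.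
have nSy : ~ S y0.
  move=> Sy; have [_ _ nSl _] := hS.
  have [q1 [q2 E]] := halftree_cross hS yq Sy nSl.
  by move: zq; rewrite E mem_cat !inE eqxx orbT.
have Sz : S z by case: hS.
have SZ := halftree_sub treeV hZ hS nSy Zz Sz.
have [g1 S1] := halftree_orbit v hS.
have [p' [yp' lp' up']] := ex_upath treeV y0 (act g1 v).
have zp' : z \in p'.
  have [|q1 [q2 E]] := halftree_cross (halftreeC treeV hS) yp' nSy.
    by rewrite lp'; apply.
  have : z \in y0 :: p' by rewrite E mem_cat !inE eqxx !orbT.
  by rewrite inE => /predU1P[E'|//]; rewrite E' in Zz.
apply: (fixed_convex treeV _ _ yp' up' _ _ zp').
- by move=> a b; rewrite act_adj.
- exact: act_inj.
- exact: fixv.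
- by rewrite lp'; apply: fixv; exact: ZX (SZ _ S1).
Qed.

(** Being moved off itself passes to smaller sets, so the elements can be treated one at a time. *)
Lemma halftree_moved_all (s : seq G) U : (forall f, f \in s -> f <> 1%g) ->
  is_halftree U -> exists U', [/\ is_halftree U', U' `<=` U &
    forall f, f \in s -> forall z, U' z -> ~ U' (act f z)].
Proof.
elim: s U => [|f s IH] U sP hU; first by exists U; split.
have [|U1 [hU1 U1U mv]] := halftree_moved (sP f _) hU; first exact: mem_head.
have [|U2 [hU2 U2U1 mv2]] := IH U1 _ hU1.
  by move=> g gs; apply: sP; rewrite inE gs orbT.
exists U2; split=> //; first exact: subset_trans U1U.
move=> g; rewrite inE => /predU1P[->|]; last exact: mv2.
by move=> z /U2U1/mv nU /U2U1.
Qed.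

(** * Disjoint translates by elements of a normal subgroup *)

Section Normal.
Variable H : {pred G}.
Hypothesis nH : normal_subgroup H.
Hypothesis ntH : nontrivial_subgroup H.

(** A nontrivial [h] of [H] moves some [W] off itself, and [e] takes the complement of [W] into a
    piece [U1] of [W]. The conjugate [c] of [e^-1] by [h] takes [W] out of [W], so [k = c e] maps
    the complement of [W] into itself. *)
Lemma normal_halftree_translates U : is_halftree U -> exists h : nat -> G,
  (forall n, h n \in H) /\
  forall m n z, ~ U (act (h m)^-1%g z) -> ~ U (act (h n)^-1%g z) -> m = n.
Proof.
move=> hU; case: nH => -[H1 Hdiv] Hconj; case: ntH => h hH h1.
have HV x : x \in H -> (x^-1)%g \in H by move=> xH; rewrite -[(x^-1)%g]mul1g Hdiv.
have HM x y : x \in H -> y \in H -> (x * y)%g \in H.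
  by move=> xH yH; rewrite -[y]invgK Hdiv// HV.
have HX x n : x \in H -> (x ^+ n)%g \in H.
  by move=> xH; elim: n => [//|n IH]; rewrite expgS HM.
have [W [hW _ mvW]] := halftree_moved h1 hU.
have [U1 [U2 [hU1 hU2 U1W U2W d12]]] := halftree_two hW.
have [e eP] := halftree_into (is_halftreeC hW) hU1.
(* [k] is a commutator of [h] and [e^-1]; read as [h] times a conjugate of [h^-1], it lies in [H] by
   normality. *)
pose c := (h * e^-1 * h^-1)%g; pose k := (c * e)%g.
have kH : k \in H.
  have -> : k = (h * (h^-1 ^ e))%g by rewrite /k /c conjgE !mulgA.
  by rewrite HM// Hconj// HV.
have cW u : W u -> ~ W (act c u).
  move=> Wu; rewrite /c !actM; apply: (mvW); apply: contrapT => nW.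
  have /(U1W _) := eP _ nW; rewrite actVK => Wh.
  by apply: (mvW _ Wh); rewrite actVK.
(* [Y] is wandering for [k]: it lies outside [W], and positive powers of [k] send the complement of
   [W] into [tr c U1], which is disjoint from [Y]. Conjugating by a [g] that takes the complement of
   [U] into [Y] gives the required elements. *)
pose Y := tr c U2; have hY : is_halftree Y by exact: is_halftree_tr.
have YW z : Y z -> ~ W z by move=> /U2W/cW; rewrite actVK.
have kW n z : ~ W z -> U1 (act c^-1%g (act (k ^+ n.+1)%g z)).
  elim: n z => [|n IH] z nW; first by rewrite /k actM actK; exact: eP.
  rewrite expgSr actM; apply: IH; rewrite /k actM; apply: cW.
  exact/U1W/eP.
have [g gP] := halftree_into (is_halftreeC hU) hY.
exists (fun n => (k ^+ n) ^ g)%g; split=> [n|m n z].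
  by rewrite Hconj// HX.
have disj i j w : (i < j)%N -> Y (act (k ^+ i)^-1%g w) -> Y (act (k ^+ j)^-1%g w) ->
    False.
  move=> ij Yi /YW/(kW (j - i.+1)%N).
  have E : (k ^+ (j - i) * (k ^+ j)^-1 = (k ^+ i)^-1)%g.
    by apply: (mulgI (k ^+ i)%g); rewrite mulgA -expgnDr subnKC ?mulgV// ltnW.
  rewrite subnSK// -[act (k ^+ (j - i))%g _]actM E => Ui.
  by rewrite -[False]/(set0 (act c^-1%g (act (k ^+ i)^-1%g w))) -d12.
have conjE i : act ((k ^+ i) ^ g)^-1%g z = act g^-1%g (act (k ^+ i)^-1%g (act g z)).
  by rewrite -!actM; congr act; rewrite conjgE !invgM invgK ?mulgA.
rewrite !conjE => /gP + /gP; rewrite !actVK => Ym Yn.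
by case: (ltngtP m n) => // /disj mn; [case: (mn _ Ym Yn)|case: (mn _ Yn Ym)].
Qed.

(** The half-tree is pulled back along the orbit map of a vertex, since operators on the Hilbert
    space of [G] see only left translations of subsets of [G]. *)
Theorem relative_powers (s : seq G) : (forall f, f \in s -> f <> 1%g) ->
  exists (C : set G) (h : nat -> G),
  [/\ forall n, h n \in H, forall f k, f \in s -> C k -> ~ C (f * k)%g &
      forall m n k, ~ C ((h m)^-1 * k)%g -> ~ C ((h n)^-1 * k)%g -> m = n].
Proof.
move=> sP; have [U hU] := ex_halftree.
have [U' [hU' _ mv]] := halftree_moved_all sP hU.
have [h [hH hP]] := normal_halftree_translates hU'.
case: (treeV) => -[x _] _ _ _ _.
exists [set k | U' (act k x)], h; split=> //= [f k fs|m n k].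
  by rewrite actM; exact: mv.
by rewrite !actM; exact: hP.
Qed.

End Normal.
End Faithful.
End Minimal.
End Action.

(** * The Hilbert space of square-summable families *)

Import Order.TTheory GRing.Theory Num.Theory.
Local Open Scope ring_scope.

Local Notation normc := ComplexField.Normc.normc.

(** * Absolutely summable real families *)

Section RealSums.
Variables (R : realType) (I : choiceType).
Implicit Types f g p q : I -> R.

Definition rsummable f := (\esum_(i in [set: I]) `|f i|%:E < +oo)%E.
(** Meant for nonnegative summable [f]: [esum] is a supremum of finite sums, and [fine] sends
    infinity to [0]. *)
Definition nsum f : R := fine (\esum_(i in [set: I]) (f i)%:E).

Lemma rsummable_le f g : (forall i, `|f i| <= g i) -> rsummable g -> rsummable f.
Proof.
move=> fg; apply: le_lt_trans; apply: le_esum => i _; rewrite lee_fin.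
exact: le_trans (fg i) (ler_norm _).
Qed.

Lemma rsummable_norm f : rsummable f -> rsummable (fun i => `|f i|).
Proof. by move=> hf; rewrite /rsummable; under eq_esum do rewrite normr_id. Qed.

Lemma rsummableD f g : rsummable f -> rsummable g ->
  rsummable (fun i => f i + g i).
Proof.
move=> hf hg.
apply: (@le_lt_trans _ _ (\esum_(i in [set: I]) (`|f i|%:E + `|g i|%:E))%E).
  by apply: le_esum => i _; rewrite -EFinD lee_fin ler_normD.
by rewrite esumD ?lte_add_pinfty.
Qed.

Lemma rsummableN f : rsummable f -> rsummable (fun i => - f i).
Proof. by rewrite /rsummable => hf; under eq_esum do rewrite normrN. Qed.

Lemma rsummable0 : rsummable (fun=> 0).
Proof. by rewrite /rsummable esum1 ?ltry// => i _; rewrite normr0. Qed.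

Lemma nsum_fin f : (forall i, 0 <= f i) -> rsummable f ->
  \esum_(i in [set: I]) (f i)%:E = (nsum f)%:E.
Proof.
move=> f0 hf; rewrite fineK// ge0_fin_numE ?esum_ge0// => [|i _]; rewrite ?lee_fin//.
by apply: le_lt_trans hf; apply: le_esum => i _; rewrite lee_fin ler_norm.
Qed.

Lemma nsum_ge0 f : (forall i, 0 <= f i) -> 0 <= nsum f.
Proof. by move=> f0; rewrite fine_ge0// esum_ge0// => i _; rewrite lee_fin. Qed.

Lemma nsumD f g : (forall i, 0 <= f i) -> (forall i, 0 <= g i) ->
  rsummable f -> rsummable g -> nsum (fun i => f i + g i) = nsum f + nsum g.
Proof.
move=> f0 g0 hf hg; rewrite {1}/nsum.
under eq_esum do rewrite EFinD.
by rewrite esumD// ?nsum_fin// => i _; rewrite lee_fin.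
Qed.

Lemma esumZ_le (c : R) f : 0 <= c -> (forall i, 0 <= f i) ->
  (\esum_(i in [set: I]) (c * f i)%:E <= c%:E * \esum_(i in [set: I]) (f i)%:E)%E.
Proof.
move=> c0 f0; apply: ge_ereal_sup => _ [X [finX _] <-].
under eq_fsbigr do rewrite EFinM.
rewrite -ge0_mule_fsumr; last by move=> i; rewrite lee_fin.
by apply: lee_wpmul2l; rewrite ?lee_fin//; apply: esum_ge; exists X.
Qed.

Lemma rsummableZ (c : R) f : rsummable f -> rsummable (fun i => c * f i).
Proof.
move=> hf; rewrite /rsummable; under eq_esum do rewrite normrM.
apply: le_lt_trans (esumZ_le _ _) _ => //.
by rewrite nsum_fin// -?EFinM ?ltry// /rsummable; under eq_esum do rewrite normr_id.
Qed.

Lemma nsumZ (c : R) f : 0 <= c -> (forall i, 0 <= f i) -> rsummable f ->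
  nsum (fun i => c * f i) = c * nsum f.
Proof.
move=> c0 f0 hf.
have le (d : R) g : 0 <= d -> (forall i, 0 <= g i) -> rsummable g ->
    nsum (fun i => d * g i) <= d * nsum g.
  move=> d0 g0 hg; rewrite -lee_fin EFinM -!nsum_fin//; first exact: esumZ_le.
    by move=> i; rewrite mulr_ge0.
  exact: rsummableZ.
apply/eqP; rewrite eq_le le//=; have [->|c_neq0] := eqVneq c 0.
  by rewrite mul0r nsum_ge0// => i; rewrite mul0r.
have {c_neq0}c0 : 0 < c by rewrite lt_def c_neq0.
rewrite -ler_pdivlMl//; apply: le_trans (le _ _ _ _ _).
- rewrite (_ : (fun i => _) = f)//; apply/funext => i.
  by rewrite mulKf// gt_eqF.
- by rewrite invr_ge0 ltW.
- by move=> i; rewrite mulr_ge0// ltW.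
- exact: rsummableZ.
Qed.

Lemma nsum_supp1 f j : (forall i, i != j -> f i = 0) -> 0 <= f j ->
  \esum_(i in [set: I]) (f i)%:E = (f j)%:E.
Proof.
move=> fj f0; transitivity (\esum_(i in [set j]) (f i)%:E)%E; last first.
  by rewrite esum_set1 ?lee_fin.
rewrite [RHS]esum_mkcond; apply: eq_esum => i _.
case: ifPn => // /negP ij; rewrite fj//; apply/eqP => E.
by apply: ij; rewrite inE.
Qed.

(** Positive and negative parts are not additive in [f]. Since every splitting into nonnegative
    summable families computes [rsum], linearity can be checked on [(|f| + f) - |f|] instead. *)
Lemma rsumE p q f : (forall i, 0 <= p i) -> (forall i, 0 <= q i) ->
  rsummable p -> rsummable q -> (forall i, f i = p i - q i) ->
  rsum f = nsum p - nsum q.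
Proof.
move=> p0 q0 hp hq fE; rewrite /rsum.
have -> : (EFin \o f = (EFin \o p) \- (EFin \o q))%E.
  by apply/funext => i /=; rewrite fE EFinB.
rewrite esumB//; first by rewrite !nsum_fin.
- by move=> i _; rewrite lee_fin.
- by move=> i _; rewrite lee_fin.
Qed.

Lemma rsum_pos f : rsummable f ->
  rsum f = nsum (fun i => `|f i| + f i) - nsum (fun i => `|f i|).
Proof.
move=> hf; apply: rsumE => // [i|||i].
- by rewrite -lerBlDl sub0r lerNl -normrN ler_norm.
- by apply: rsummableD => //; exact: rsummable_norm.
- exact: rsummable_norm.
- by rewrite addrAC subrr add0r.
Qed.

Lemma rsum0 : rsum (fun _ : I => 0 : R) = 0.
Proof.
by rewrite (@rsumE (fun=> 0) (fun=> 0)) ?subrr//; exact: rsummable0.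
Qed.

Lemma rsumD f g : rsummable f -> rsummable g ->
  rsum (fun i => f i + g i) = rsum f + rsum g.
Proof.
move=> hf hg; have [hf' hg'] := (rsummable_norm hf, rsummable_norm hg).
have pos (h : I -> R) i : 0 <= `|h i| + h i.
  by rewrite -lerBlDl sub0r lerNl -normrN ler_norm.
rewrite (@rsumE (fun i => (`|f i| + f i) + (`|g i| + g i))
  (fun i => `|f i| + `|g i|)).
- rewrite !rsum_pos// nsumD//; [|exact: rsummableD..].
  rewrite [nsum (fun i => `|f i| + `|g i|)]nsumD//; ring.
- by move=> i; rewrite addr_ge0.
- by move=> i; rewrite addr_ge0.
- by apply: rsummableD; exact: rsummableD.
- exact: rsummableD.
- by move=> i; ring.
Qed.

Lemma rsumN f : rsummable f -> rsum (fun i => - f i) = - rsum f.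
Proof.
move=> hf; have hf' := rsummable_norm hf.
rewrite (@rsumE (fun i => `|f i|) (fun i => `|f i| + f i))//.
- by rewrite rsum_pos// opprB.
- by move=> i; rewrite -lerBlDl sub0r lerNl -normrN ler_norm.
- exact: rsummableD.
- by move=> i; ring.
Qed.

Lemma rsumZ (c : R) f : rsummable f -> rsum (fun i => c * f i) = c * rsum f.
Proof.
wlog c0 : c / 0 <= c => [W hf|hf].
  have [/W->//|/ltW c0] := leP 0 c.
  have -> : (fun i => c * f i) = (fun i => - (- c * f i)).
    by apply/funext => i; rewrite mulNr opprK.
  by rewrite rsumN ?W ?oppr_ge0//; [rewrite mulNr opprK|exact: rsummableZ].
have hf' := rsummable_norm hf.
have pos i : 0 <= `|f i| + f i by rewrite -lerBlDl sub0r lerNl -normrN ler_norm.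
have hp : rsummable (fun i => `|f i| + f i) by exact: rsummableD.
rewrite (@rsumE (fun i => c * (`|f i| + f i)) (fun i => c * `|f i|)).
- by rewrite !nsumZ// -mulrBr rsum_pos.
- by move=> i; rewrite mulr_ge0.
- by move=> i; rewrite mulr_ge0.
- exact: rsummableZ.
- exact: rsummableZ.
- by move=> i; ring.
Qed.

Lemma rsum_ge0 f : (forall i, 0 <= f i) -> rsummable f -> rsum f = nsum f.
Proof.
move=> f0 hf; rewrite (@rsumE f (fun=> 0))//.
- by rewrite /nsum [X in _ - fine X]esum1// subr0.
- exact: rsummable0.
- by move=> i; rewrite subr0.
Qed.

Lemma rsum_supp1 f j : (forall i, i != j -> f i = 0) -> rsum f = f j.
Proof.
move=> fj; have hf : rsummable f.
  by rewrite /rsummable (@nsum_supp1 (fun i => `|f i|) j) ?ltry// => i /fj ->; rewrite normr0.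
rewrite rsum_pos// /nsum (@nsum_supp1 _ j) ?(@nsum_supp1 (fun i => `|f i|) j)//=.
- by rewrite addrAC subrr add0r.
- by move=> i /fj ->; rewrite normr0.
- by move=> i /fj ->; rewrite normr0 addr0.
- by rewrite -lerBlDl sub0r lerNl -normrN ler_norm.
Qed.

End RealSums.

(** * Inner product and norm *)

Section HilbertSpace.
Variables (R : realType) (I : choiceType).
Implicit Types (xi eta zeta : ell2 R I) (c : R[i]).
Local Notation N := (@ell2norm R I).

Lemma ell2P xi eta : (forall i, xi i = eta i) -> xi = eta.
Proof. by move=> h; apply: val_inj; apply/funext. Qed.

Lemma ell2DE xi eta i : (xi + eta) i = xi i + eta i. Proof. by []. Qed.
Lemma ell2ZE c xi i : (c *: xi) i = c * xi i. Proof. by []. Qed.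
Lemma ell20E i : (0 : ell2 R I) i = 0. Proof. by []. Qed.

Lemma sqr_normcE (a b : R) : normc (a +i* b)%C ^+ 2 = a ^+ 2 + b ^+ 2.
Proof. by rewrite /= sqr_sqrtr// addr_ge0// sqr_ge0. Qed.

Lemma normc_ge0 c : 0 <= normc c.
Proof. by case: c => a b; rewrite sqrtr_ge0. Qed.

Lemma mulc_conj c : c * (c^*)%C = ((normc c ^+ 2)%:C)%C.
Proof.
by case: c => a b; rewrite sqr_normcE; apply/eqP; rewrite eq_complex /=;
  apply/andP; split; apply/eqP; ring.
Qed.

Lemma ell2_summable xi : rsummable (fun i => normc (xi i) ^+ 2).
Proof.
case: xi => xi /= /asboolP; apply: le_lt_trans; apply: le_esum => i _.
by rewrite lee_fin ger0_norm// sqr_ge0.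
Qed.

Lemma sqr_ell2norm xi : N xi ^+ 2 = nsum (fun i => normc (xi i) ^+ 2).
Proof.
by rewrite sqr_sqrtr//; apply: nsum_ge0 => i; rewrite sqr_ge0.
Qed.

Lemma ell2norm_ge0 xi : 0 <= N xi. Proof. exact: sqrtr_ge0. Qed.

Lemma dotp_summable xi eta :
  rsummable (fun i => complex.Re (xi i * (eta i)^*%C)) /\
  rsummable (fun i => complex.Im (xi i * (eta i)^*%C)).
Proof.
have hs := rsummableD (ell2_summable xi) (ell2_summable eta).
split; apply: (rsummable_le _ hs) => i /=; case: (xi i) (eta i) => [a b] [x y];
  rewrite !sqr_normcE /= ler_norml; apply/andP; split;
  rewrite -subr_ge0.
- have -> : a * x - b * - y - - (a ^+ 2 + b ^+ 2 + (x ^+ 2 + y ^+ 2)) =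
    ((a + x) ^+ 2 + (b + y) ^+ 2 + a ^+ 2 + b ^+ 2 + x ^+ 2 + y ^+ 2) / 2 by field.
  by rewrite divr_ge0// !addr_ge0// sqr_ge0.
- have -> : a ^+ 2 + b ^+ 2 + (x ^+ 2 + y ^+ 2) - (a * x - b * - y) =
    ((a - x) ^+ 2 + (b - y) ^+ 2 + a ^+ 2 + b ^+ 2 + x ^+ 2 + y ^+ 2) / 2 by field.
  by rewrite divr_ge0// !addr_ge0// sqr_ge0.
- have -> : a * - y + b * x - - (a ^+ 2 + b ^+ 2 + (x ^+ 2 + y ^+ 2)) =
    ((a - y) ^+ 2 + (b + x) ^+ 2 + a ^+ 2 + b ^+ 2 + x ^+ 2 + y ^+ 2) / 2 by field.
  by rewrite divr_ge0// !addr_ge0// sqr_ge0.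
- have -> : a ^+ 2 + b ^+ 2 + (x ^+ 2 + y ^+ 2) - (a * - y + b * x) =
    ((a + y) ^+ 2 + (b - x) ^+ 2 + a ^+ 2 + b ^+ 2 + x ^+ 2 + y ^+ 2) / 2 by field.
  by rewrite divr_ge0// !addr_ge0// sqr_ge0.
Qed.

Lemma complexP (x y : R[i]) : complex.Re x = complex.Re y ->
  complex.Im x = complex.Im y -> x = y.
Proof. by case: x y => [a b] [c d] /= -> ->. Qed.

Lemma ReD (x y : R[i]) : complex.Re (x + y) = complex.Re x + complex.Re y.
Proof. by case: x y => [? ?] []. Qed.
Lemma ImD (x y : R[i]) : complex.Im (x + y) = complex.Im x + complex.Im y.
Proof. by case: x y => [? ?] []. Qed.
Lemma ReM (x y : R[i]) : complex.Re (x * y) =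
  complex.Re x * complex.Re y - complex.Im x * complex.Im y.
Proof. by case: x y => [? ?] []. Qed.
Lemma ImM (x y : R[i]) : complex.Im (x * y) =
  complex.Re x * complex.Im y + complex.Im x * complex.Re y.
Proof. by case: x y => [? ?] [? ?] /=; ring. Qed.
Lemma Re_dotp xi eta :
  complex.Re (dotp xi eta) = rsum (fun i => complex.Re (xi i * (eta i)^*%C)).
Proof. by []. Qed.
Lemma Im_dotp xi eta :
  complex.Im (dotp xi eta) = rsum (fun i => complex.Im (xi i * (eta i)^*%C)).
Proof. by []. Qed.

Lemma dotpDl xi eta zeta : dotp (xi + eta) zeta = dotp xi zeta + dotp eta zeta.
Proof.
have [r1 i1] := dotp_summable xi zeta; have [r2 i2] := dotp_summable eta zeta.
apply: complexP; rewrite ?ReD ?ImD ?Re_dotp ?Im_dotp -rsumD//;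
  by congr rsum; apply/funext => i; rewrite ell2DE mulrDl ?ReD ?ImD.
Qed.

Lemma dotpZl c xi eta : dotp (c *: xi) eta = c * dotp xi eta.
Proof.
have [r1 i1] := dotp_summable xi eta.
apply: complexP; rewrite ?ReM ?ImM Re_dotp Im_dotp.
  rewrite -(rsumZ _ r1) -(rsumZ _ i1) -(rsumN (rsummableZ _ i1)).
  rewrite -(rsumD (rsummableZ _ r1) (rsummableN (rsummableZ _ i1))).
  by congr rsum; apply/funext => i; rewrite ell2ZE -mulrA ReM.
rewrite -(rsumZ _ r1) -(rsumZ _ i1) -(rsumD (rsummableZ _ i1) (rsummableZ _ r1)).
by congr rsum; apply/funext => i; rewrite ell2ZE -mulrA ImM.
Qed.

Lemma dotpC xi eta : dotp eta xi = ((dotp xi eta)^*)%C.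
Proof.
have [r1 i1] := dotp_summable xi eta.
have ReJ (x : R[i]) : complex.Re (x^*)%C = complex.Re x by case: x.
have ImJ (x : R[i]) : complex.Im (x^*)%C = - complex.Im x by case: x.
apply: complexP; rewrite ?ReJ ?ImJ ?Re_dotp ?Im_dotp -?rsumN//;
  congr rsum; apply/funext => i; case: (xi i) (eta i) => [a b] [x y] /=; ring.
Qed.

Lemma dotpxx xi : dotp xi xi = ((N xi ^+ 2)%:C)%C.
Proof.
apply: complexP.
  rewrite Re_dotp [RHS]/= sqr_ell2norm -rsum_ge0.
  - by congr rsum; apply/funext => i; rewrite mulc_conj.
  - by move=> i; rewrite sqr_ge0.
  - exact: ell2_summable.
rewrite Im_dotp [RHS]/= (_ : (fun i => _) = fun=> 0) ?rsum0//.
by apply/funext => i; rewrite mulc_conj.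
Qed.

Lemma dotpDr xi eta zeta : dotp zeta (xi + eta) = dotp zeta xi + dotp zeta eta.
Proof. by rewrite dotpC dotpDl [dotp zeta xi]dotpC [dotp zeta eta]dotpC rmorphD. Qed.

Lemma dotpZr c xi eta : dotp eta (c *: xi) = (c^*)%C * dotp eta xi.
Proof. by rewrite dotpC dotpZl [dotp eta xi]dotpC rmorphM. Qed.

Lemma dotpBl xi eta zeta : dotp (xi - eta) zeta = dotp xi zeta - dotp eta zeta.
Proof. by rewrite dotpDl -scaleN1r dotpZl mulN1r. Qed.

Lemma dotpBr xi eta zeta : dotp zeta (xi - eta) = dotp zeta xi - dotp zeta eta.
Proof. by rewrite dotpDr -scaleN1r dotpZr rmorphN1 mulN1r. Qed.

Lemma dotp0l xi : dotp 0 xi = 0.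
Proof. by rewrite -(scale0r xi) dotpZl mul0r. Qed.

Lemma dotp0r xi : dotp xi 0 = 0.
Proof. by rewrite dotpC dotp0l conjc0. Qed.

Lemma normc_coord_le xi i : normc (xi i) <= N xi.
Proof.
rewrite -(@ler_pXn2r _ 2) ?nnegrE ?ell2norm_ge0 ?normc_ge0// sqr_ell2norm.
rewrite -lee_fin -nsum_fin; [|by move=> j; rewrite sqr_ge0|exact: ell2_summable].
apply: esum_ge; exists [set i]; first by split=> //; exact: finite_set1.
by rewrite fsbig_set1.
Qed.

Lemma ell2norm_eq0 xi : N xi = 0 -> xi = 0.
Proof.
move=> n0; apply: ell2P => i; apply: ComplexField.Normc.eq0_normc.
by apply/eqP; rewrite eq_le normc_ge0 andbT -n0 normc_coord_le.
Qed.

Lemma ell2norm0 : N 0 = 0.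
Proof.
by apply/eqP; rewrite -[_ == 0]sqrf_eq0 -(inj_eq (@complexI R)) -dotpxx dotp0l.
Qed.

Lemma ell2normZ c xi : N (c *: xi) = normc c * N xi.
Proof.
apply/eqP; rewrite -(@eqrXn2 _ 2) ?mulr_ge0 ?ell2norm_ge0 ?normc_ge0//.
rewrite -(inj_eq (@complexI R)) -dotpxx dotpZl dotpZr mulrA mulc_conj dotpxx.
by rewrite exprMn -rmorphM.
Qed.

Lemma cauchy_schwarz xi eta : normc (dotp xi eta) <= N xi * N eta.
Proof.
have [n0|n0] := eqVneq (N eta) 0.
  rewrite n0 mulr0 (ell2norm_eq0 n0) dotp0r.
  by rewrite ComplexField.Normc.normc0.
set u := dotp xi eta.
(* The usual projection argument, scaled by [N eta ^+ 2] to avoid division. *)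
have := dotpxx (((N eta ^+ 2)%:C)%C *: xi - u *: eta).
have uC : dotp eta xi = (u^*)%C by rewrite dotpC.
rewrite -scaleNr dotpDl !dotpDr !dotpZl !dotpZr !dotpxx -/u uC conjc_real.
have uu := mulc_conj u.
set v := (u^*)%C in uu *; rewrite rmorphN -/v.
set e := ((N eta ^+ 2)%:C)%C; set x := ((N xi ^+ 2)%:C)%C.
have -> : e * (e * x) + e * (- v * u) + (- u * (e * v) + - u * (- v * e)) =
  e * (e * x - u * v) by ring.
rewrite uu -rmorphM -rmorphB -rmorphM => /complexI E.
have e0 : 0 < N eta ^+ 2 by rewrite exprn_gt0// lt_def n0 ell2norm_ge0.
have : 0 <= N eta ^+ 2 * N xi ^+ 2 - normc u ^+ 2.
  by rewrite -(pmulr_rge0 _ e0) E sqr_ge0.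
rewrite subr_ge0 -exprMn mulrC.
by rewrite ler_pXn2r ?nnegrE ?mulr_ge0 ?ell2norm_ge0 ?normc_ge0.
Qed.

Lemma ell2norm_triangle xi eta : N (xi + eta) <= N xi + N eta.
Proof.
rewrite -(@ler_pXn2r _ 2) ?nnegrE ?addr_ge0 ?ell2norm_ge0//.
have := dotpxx (xi + eta); rewrite dotpDl !dotpDr !dotpxx [dotp eta xi]dotpC.
move: (dotp xi eta) (cauchy_schwarz xi eta) => -[a b] cs.
move/(congr1 (@complex.Re R)) => /= <-.
have le : a <= normc (a +i* b)%C.
  by rewrite (le_trans (ler_norm a))//= -sqrtr_sqr ler_wsqrtr// lerDl sqr_ge0.
by have := le_trans le cs; rewrite sqrrD; lra.
Qed.

Lemma ell2normN xi : N (- xi) = N xi.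
Proof.
rewrite -scaleN1r ell2normZ; set m := normc _.
suff -> : m = 1 by rewrite mul1r.
by rewrite /m -[-1]/((-1) +i* (- 0))%C /= oppr0 expr0n addr0 sqrrN expr1n sqrtr1.
Qed.

Lemma ell2norm_orth xi eta : dotp xi eta = 0 ->
  N (xi + eta) ^+ 2 = N xi ^+ 2 + N eta ^+ 2.
Proof.
move=> o; apply: (@complexI R); rewrite rmorphD -dotpxx dotpDl !dotpDr o.
by rewrite [dotp eta xi]dotpC o conjc0 addr0 add0r !dotpxx.
Qed.

Lemma dotp_disjoint xi eta : (forall i, xi i = 0 \/ eta i = 0) -> dotp xi eta = 0.
Proof.
move=> d; have E i : xi i * (eta i)^*%C = 0.
  by case: (d i) => ->; rewrite ?conjc0 ?mul0r ?mulr0.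
by apply: complexP; rewrite ?Re_dotp ?Im_dotp; under eq_fun do rewrite E; exact: rsum0.
Qed.

End HilbertSpace.

(** * Restrictions, basis vectors, bounded operators and adjoints *)

Section Operators.
Variables (R : realType) (I : choiceType).
Implicit Types (xi eta zeta : ell2 R I) (c : R[i]) (D : set I).
Local Notation N := (@ell2norm R I).
Implicit Types (T S : ell2 R I -> ell2 R I) (M : R).

Lemma restr_square_summable D xi :
  (fun i => if `[< D i >] then xi i else 0) \in @square_summable R I.
Proof.
have hxi : (xi : I -> R[i]) \in @square_summable R I by case: xi.
apply: (square_summable_le (M := 1)) hxi => i.
by rewrite mul1r; case: ifP => // _; rewrite ComplexField.Normc.normc0 expr0n sqr_ge0.
Qed.

Definition restr D xi : ell2 R I := Ell2 (restr_square_summable D xi).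

Lemma restr_in D xi i : D i -> restr D xi i = xi i.
Proof. by move=> Di /=; rewrite asboolT. Qed.

Lemma restr_out D xi i : ~ D i -> restr D xi i = 0.
Proof. by move=> Di /=; rewrite asboolF. Qed.

Lemma restrK D xi : restr D xi + restr (~` D) xi = xi.
Proof.
apply: ell2P => i; rewrite ell2DE; have [Di|Di] := pselect (D i).
  by rewrite restr_in// restr_out ?addr0//; apply.
by rewrite restr_out// restr_in ?add0r.
Qed.

Lemma sqr_norm_restr D xi : N xi ^+ 2 = N (restr D xi) ^+ 2 + N (restr (~` D) xi) ^+ 2.
Proof.
rewrite -ell2norm_orth ?restrK// dotp_disjoint// => i.
by have [Di|Di] := pselect (D i); [right|left]; rewrite restr_out//; apply.
Qed.

Lemma norm_restr_le D xi : N (restr D xi) <= N xi.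
Proof.
rewrite -(@ler_pXn2r _ 2) ?nnegrE ?ell2norm_ge0//.
by rewrite (sqr_norm_restr D xi) lerDl sqr_ge0.
Qed.

Lemma delta_square_summable (j : I) :
  (fun i => if i == j then 1 else 0 : R[i]) \in @square_summable R I.
Proof.
apply/asboolP; rewrite /sqnorm (@nsum_supp1 _ _ _ j) ?ltry ?sqr_ge0// => i /negPf ->.
by rewrite ComplexField.Normc.normc0 expr0n.
Qed.

Definition delta (j : I) : ell2 R I := Ell2 (delta_square_summable j).

Lemma deltaE j i : delta j i = if i == j then 1 else 0. Proof. by []. Qed.

Lemma dotp_delta xi j : dotp xi (delta j) = xi j.
Proof.
apply: complexP; rewrite (Re_dotp, Im_dotp) (@rsum_supp1 _ _ _ j) => [|i /negPf ij].
- by rewrite deltaE eqxx conjc1 mulr1.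
- by rewrite deltaE ij conjc0 mulr0.
- by rewrite deltaE eqxx conjc1 mulr1.
- by rewrite deltaE ij conjc0 mulr0.
Qed.

Lemma finite_support_dense xi (e : R) : 0 < e ->
  exists s, uniq s /\ N (xi - restr [set` s] xi) <= e.
Proof.
move=> e0; have e2 : 0 < e ^+ 2 by rewrite exprn_gt0.
have f0 i : 0 <= normc (xi i) ^+ 2 by rewrite sqr_ge0.
have nE := nsum_fin f0 (ell2_summable xi).
have [|_ [X [finX _] <-]] := @ub_ereal_sup_adherent _
  [set (\sum_(x \in A) (normc (xi x) ^+ 2)%:E)%E | A in fsets [set: I]] _ e2.
  by rewrite -/(esum _ _) nE.
rewrite -/(esum _ _) nE -sqr_ell2norm => lt.
exists (finmap.enum_fset (fset_set X)); split; first exact: finmap.fset_uniq.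
have -> : [set` finmap.enum_fset (fset_set X)] = X.
  by apply/seteqP; split=> i /=; rewrite in_fset_set// inE.
have -> : xi - restr X xi = restr (~` X) xi by rewrite -{1}(restrK X xi) addrAC subrr add0r.
rewrite -(@ler_pXn2r _ 2) ?nnegrE ?ell2norm_ge0 ?(ltW e0)//.
have : (\sum_(x \in X) (normc (xi x) ^+ 2)%:E <= (N (restr X xi) ^+ 2)%:E)%E.
  rewrite sqr_ell2norm -nsum_fin; [|by move=> i; rewrite sqr_ge0|exact: ell2_summable].
  apply: esum_ge; exists X => //; apply: lee_fsum => // i Xi.
  by rewrite restr_in.
move/(lt_le_trans lt); rewrite -EFinB lte_fin (sqr_norm_restr X xi); lra.
Qed.

(** Finitely supported vectors are dense. This reduces identities between bounded functionals to
    basis vectors. *)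
Lemma functional_eq0 (F : ell2 R I -> R[i]) (M : R) :
  (forall xi eta, F (xi + eta) = F xi + F eta) ->
  (forall c xi, F (c *: xi) = c * F xi) ->
  (forall xi, normc (F xi) <= M * N xi) ->
  (forall j, F (delta j) = 0) -> forall xi, F xi = 0.
Proof.
move=> FD FZ FM Fd xi.
have Fs s : uniq s -> F (restr [set` s] xi) = 0.
  elim: s => [_|a s IH /= /andP[as_ us]].
    have -> : restr [set` [::]] xi = 0 *: xi.
      by apply: ell2P => i; rewrite restr_out// scale0r.
    by rewrite FZ mul0r.
  have -> : restr [set` a :: s] xi = restr [set` s] xi + xi a *: delta a.
    apply: ell2P => i; rewrite ell2DE ell2ZE deltaE.
    have [->|ia] := eqVneq i a.
      rewrite restr_in ?restr_out ?add0r ?mulr1//=; first exact/negP.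
      exact: mem_head.
    rewrite mulr0 addr0; have [si|si] := boolP (i \in s).
      by rewrite !restr_in//= inE si orbT.
    by rewrite !restr_out//=; apply/negP; rewrite // inE negb_or ia.
  by rewrite FD FZ Fd mulr0 addr0 IH.
have M0 : 0 <= `|M| + 1 by rewrite addr_ge0.
apply: ComplexField.Normc.eq0_normc; apply/eqP; rewrite eq_le normc_ge0 andbT.
apply/ler_addgt0Pl => e e0; rewrite ?addr0 ?add0r.
have d0 : 0 < e / (`|M| + 1) by rewrite divr_gt0// ltr_wpDl.
have [s [us le]] := finite_support_dense xi d0.
have -> : F xi = F (xi - restr [set` s] xi).
  by rewrite FD -scaleN1r FZ Fs// mulr0 addr0.
apply: le_trans (FM _) _; apply: (@le_trans _ _ ((`|M| + 1) * N (xi - restr [set` s] xi))).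
  by rewrite ler_wpM2r ?ell2norm_ge0// (le_trans (ler_norm M))// lerDl.
by rewrite mulrC -ler_pdivlMr// ltr_wpDl.
Qed.

(** Estimates are made with [opbound], which composes pointwise; the supremum [opnorm] occurs only
    at the interface with [norm_closed]. *)
Definition opbound M T := forall xi, N (T xi) <= M * N xi.

Lemma linD T : linear T -> forall xi eta, T (xi + eta) = T xi + T eta.
Proof. by move=> lT xi eta; have := lT 1 xi eta; rewrite !scale1r. Qed.

Lemma lin0 T : linear T -> T 0 = 0.
Proof. by move=> lT; apply: (addrI (T 0)); rewrite -linD// !addr0. Qed.

Lemma linZ T : linear T -> forall c xi, T (c *: xi) = c *: T xi.
Proof. by move=> lT c xi; have := lT c xi 0; rewrite (lin0 lT) !addr0. Qed.

Lemma linB T : linear T -> forall xi eta, T (xi - eta) = T xi - T eta.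
Proof. by move=> lT xi eta; rewrite linD// -scaleN1r linZ// scaleN1r. Qed.

Lemma bounded_opbound T : bounded_operator T -> opbound (opnorm T) T.
Proof.
move=> [lT [M TM]] xi.
have M0 : 0 <= `|M| by [].
have TM' eta : N (T eta) <= `|M| * N eta.
  by rewrite (le_trans (TM eta))// ler_wpM2r ?ell2norm_ge0 ?ler_norm.
have [x0|x0] := eqVneq (N xi) 0.
  by rewrite (ell2norm_eq0 x0) lin0// !ell2norm0 mulr0.
have xp : 0 < N xi by rewrite lt_def x0 ell2norm_ge0.
rewrite -ler_pdivrMr//; pose c : R[i] := (((N xi)^-1)%:C)%C.
have nc : normc c = (N xi)^-1.
  by rewrite /= expr0n addr0 sqrtr_sqr ger0_norm// invr_ge0 ltW.
apply: ub_le_sup.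
  exists `|M| => _ [eta le <-]; rewrite (le_trans (TM' eta))//.
  by rewrite -[leRHS]mulr1 ler_wpM2l.
exists (c *: xi); first by rewrite /= ell2normZ nc mulVf.
by rewrite linZ// ell2normZ nc mulrC.
Qed.

Lemma opnorm_le M T : 0 <= M -> opbound M T -> opnorm T <= M.
Proof.
move=> M0 TM; apply: ge_sup.
  by exists (N (T 0)), 0 => //=; rewrite ell2norm0.
move=> _ [xi le <-]; rewrite (le_trans (TM xi))// -[leRHS]mulr1.
by rewrite ler_wpM2l.
Qed.

Lemma bounded_id : bounded_operator (@id (ell2 R I)).
Proof. by split=> //; exists 1 => xi; rewrite mul1r. Qed.

Lemma bounded_zero : bounded_operator (0 : ell2 R I -> ell2 R I).
Proof.
split=> [c xi eta|]; first by rewrite /= scaler0 addr0.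
by exists 0 => xi; rewrite ell2norm0 mul0r.
Qed.

Lemma bounded_add T S : bounded_operator T -> bounded_operator S ->
  bounded_operator (T + S).
Proof.
move=> [lT [M TM]] [lS [M' SM]]; split=> [c xi eta|].
  by rewrite /= -[(T + S) _]/(T _ + S _) lT lS scalerDr addrACA.
exists (M + M') => xi; rewrite mulrDl (le_trans (ell2norm_triangle _ _))//.
exact: lerD.
Qed.

Lemma bounded_scale c T : bounded_operator T -> bounded_operator (c *: T).
Proof.
move=> [lT [M TM]]; split=> [d xi eta|].
  rewrite -[(c *: T) _]/(c *: T _) lT scalerDr !scalerA mulrC -scalerA.
  by rewrite scalerA.
exists (normc c * M) => xi; rewrite -[(c *: T) _]/(c *: T _) ell2normZ -mulrA.
by rewrite ler_wpM2l ?normc_ge0.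
Qed.

Lemma bounded_sub T S : bounded_operator T -> bounded_operator S ->
  bounded_operator (T - S).
Proof.
by move=> bT bS; rewrite -scaleN1r; apply: bounded_add => //; exact: bounded_scale.
Qed.

Lemma bounded_comp T S : bounded_operator T -> bounded_operator S ->
  bounded_operator (T \o S).
Proof.
move=> [lT [M TM]] [lS [M' SM]]; split=> [d xi eta|].
  by rewrite /= lS lT.
exists (`|M| * M') => xi; rewrite (le_trans (TM _))//.
rewrite (@le_trans _ _ (`|M| * N (S xi)))//.
  by rewrite ler_wpM2r ?ell2norm_ge0 ?ler_norm.
by rewrite -mulrA ler_wpM2l.
Qed.

Lemma norm_closed_opbound A T : norm_closed A -> bounded_operator T ->
  (forall e : R, 0 < e -> exists2 S, A S & opbound e (T - S)) -> A T.
Proof.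
move=> cA bT h; apply: cA => // e e0; have ltr0Sn2 : 0 < 2 :> R by [].
have [S AS le] := h (e / 2) (divr_gt0 e0 ltr0Sn2).
exists S => //; apply: (@le_lt_trans _ _ (e / 2)); last by lra.
by apply: opnorm_le => //; lra.
Qed.

Lemma opbound_lt T (e : R) : bounded_operator T -> opnorm T < e -> opbound e T.
Proof.
move=> bT lt xi; rewrite (le_trans (bounded_opbound bT xi))//.
by rewrite ler_wpM2r ?ell2norm_ge0// ltW.
Qed.

Lemma conjcD (x y : R[i]) : ((x + y)^*)%C = (x^*)%C + (y^*)%C.
Proof. by rewrite rmorphD. Qed.

Lemma conjcM (x y : R[i]) : ((x * y)^*)%C = (x^*)%C * (y^*)%C.
Proof. by rewrite rmorphM. Qed.

Lemma RCD (a b : R) : ((a + b)%:C)%C = ((a%:C)%C + (b%:C)%C : R[i]).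
Proof. by rewrite rmorphD. Qed.

Section Adjoint.
Variables (T : ell2 R I -> ell2 R I) (M : R).
Hypotheses (lT : linear T) (TM : opbound M T) (M0 : 0 <= M).

(** The coefficient at [g] that any adjoint of [T] must give to the image of [eta]. *)
Definition adj_coef eta (g : I) : R[i] := ((dotp (T (delta g)) eta)^*)%C.

(** Test on [zeta], the vector of these coefficients cut off to [s]: [Q] equals both [N zeta ^+ 2]
    and [dotp (T zeta) eta], so Cauchy-Schwarz bounds [Q] by [sqrt Q * M * N eta]. *)
Lemma adj_coef_finite eta s : uniq s ->
  \sum_(g <- s) normc (adj_coef eta g) ^+ 2 <= (M * N eta) ^+ 2.
Proof.
move=> us; set Q := \sum_(g <- s) _.
have Q0 : 0 <= Q by apply: sumr_ge0 => g _; rewrite sqr_ge0.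
have [zeta [zQ TzQ]] : exists zeta, N zeta ^+ 2 = Q /\ dotp (T zeta) eta = ((Q%:C)%C : R[i]).
  suff [zeta [z0 zQ TzQ]] : exists zeta, [/\ forall g, g \notin s -> zeta g = 0,
      N zeta ^+ 2 = Q & dotp (T zeta) eta = ((Q%:C)%C : R[i])].
    by exists zeta.
  rewrite /Q {Q Q0}; elim: s us => [_|a s IH]; last rewrite cons_uniq => /andP[nas us].
    exists 0; split=> //; first by rewrite ell2norm0 big_nil expr0n.
    by rewrite (lin0 lT) dotp0l big_nil.
  have [zeta [z0 zQ TzQ]] := IH us; have za := z0 _ nas.
  exists (zeta + adj_coef eta a *: delta a); split=> [g||].
  - rewrite inE negb_or => /andP[ga gs].
    by rewrite ell2DE ell2ZE deltaE (negPf ga) mulr0 addr0 z0.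
  - rewrite ell2norm_orth ?zQ; last by rewrite dotpZr dotp_delta za mulr0.
    rewrite big_cons addrC; congr (_ + _); rewrite ell2normZ exprMn.
    rewrite [X in _ * X](_ : _ = 1) ?mulr1//; apply: (@complexI R).
    by rewrite -dotpxx dotp_delta deltaE eqxx.
  - rewrite linD// linZ// dotpDl dotpZl TzQ big_cons addrC RCD; congr (_ + _).
    by rewrite -mulc_conj /adj_coef conjcK.
have := cauchy_schwarz (T zeta) eta; rewrite TzQ.
have -> : normc (Q%:C)%C = Q by rewrite /= expr0n addr0 sqrtr_sqr ger0_norm.
move=> le; have {}le : Q <= N zeta * (M * N eta).
  rewrite (le_trans le)// mulrA [N zeta * M]mulrC.
  by rewrite ler_wpM2r ?ell2norm_ge0.
have [->|Qn] := eqVneq Q 0; first by rewrite sqr_ge0.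
have Qp : 0 < Q by rewrite lt_def Qn.
rewrite -(ler_pM2l Qp) -[in leRHS]zQ -exprMn -expr2.
by rewrite ler_pXn2r ?nnegrE ?mulr_ge0 ?ell2norm_ge0.
Qed.

Lemma adj_coef_esum eta :
  (sqnorm (adj_coef eta) <= ((M * N eta) ^+ 2)%:E)%E.
Proof.
apply: ge_ereal_sup => _ [X [finX _] <-].
by rewrite fsbig_finite//= sumEFin lee_fin adj_coef_finite.
Qed.

Lemma adj_square_summable eta : adj_coef eta \in @square_summable R I.
Proof. by apply/asboolP; apply: le_lt_trans (adj_coef_esum eta) _; exact: ltry. Qed.

Definition adjoint eta : ell2 R I := Ell2 (adj_square_summable eta).

Lemma adjointE eta g : adjoint eta g = ((dotp (T (delta g)) eta)^*)%C.
Proof. by []. Qed.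

Lemma adjoint_linear : linear adjoint.
Proof.
move=> c xi eta; apply: ell2P => g; rewrite ell2DE ell2ZE !adjointE /adj_coef.
by rewrite dotpDr dotpZr conjcD conjcM conjcK.
Qed.

Lemma adjoint_bound : opbound M adjoint.
Proof.
move=> eta; rewrite -(@ler_pXn2r _ 2) ?nnegrE ?mulr_ge0 ?ell2norm_ge0//.
rewrite sqr_ell2norm -lee_fin -nsum_fin; first exact: adj_coef_esum.
  by move=> i; rewrite sqr_ge0.
exact: ell2_summable.
Qed.

Lemma adjoint_ofP : adjoint_of T adjoint.
Proof.
move=> xi eta; apply/eqP; rewrite -subr_eq0; apply/eqP.
apply: (@functional_eq0 (fun xi => dotp (T xi) eta - dotp xi (adjoint eta))
  (M * N eta + N (adjoint eta))) => [x y|c x|x|j].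
- by rewrite linD// !dotpDl opprD addrACA.
- by rewrite linZ// !dotpZl mulrBr.
- apply: le_trans (le_normcD _ _) _; rewrite normcN mulrDl.
  apply: lerD; apply: le_trans (cauchy_schwarz _ _) _; last by rewrite mulrC.
  by rewrite mulrAC ler_wpM2r ?ell2norm_ge0.
- by rewrite [dotp (delta j) _]dotpC dotp_delta adjointE conjcK subrr.
Qed.

End Adjoint.

Lemma adjoint_exists T : bounded_operator T ->
  exists2 S, bounded_operator S & adjoint_of T S.
Proof.
move=> [lT [M TM]]; have M0 : 0 <= `|M| by [].
have TM' : opbound `|M| T.
  move=> xi; rewrite (le_trans (TM xi))//.
  by rewrite ler_wpM2r ?ell2norm_ge0 ?ler_norm.
exists (adjoint lT TM' M0); last exact: adjoint_ofP.
by split; [exact: adjoint_linear|exists `|M|; exact: adjoint_bound].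
Qed.

End Operators.

(** * Twisted group algebras *)

Section TwistedConvolution.
Variables (R : realType) (G : groupType) (sigma : two_cocycle R G).
Implicit Types (xi eta : ell2 R G) (c : R[i]) (T S : ell2 R G -> ell2 R G).
Local Notation N := (@ell2norm R G).
Local Notation lam := (lambda sigma).

Lemma lambdaE g xi h : lam g xi h = sigma g (g^-1 * h)%g * xi (g^-1 * h)%g.
Proof. by []. Qed.

Lemma normc_cocycle g h : normc (sigma g h) = 1.
Proof. by have [] := cocycle_unimodular sigma g h. Qed.

Lemma cocycle_conj g h : sigma g h * (sigma g h)^*%C = 1.
Proof. by rewrite mulc_conj normc_cocycle expr1n. Qed.

Lemma normc_conj c : normc (c^*)%C = normc c.
Proof. by case: c => a b /=; rewrite sqrrN. Qed.

Lemma lambda_linear g : linear (lam g).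
Proof.
move=> c xi eta; apply: ell2P => h.
by rewrite ell2DE ell2ZE !lambdaE ell2DE ell2ZE mulrDr mulrCA.
Qed.

Lemma mulg_bij (g : G) : set_bij [set: G] [set: G] (fun h => (g^-1 * h)%g).
Proof.
split=> [//|h k _ _ /mulgI//|h _].
by exists (g * h)%g => //; rewrite mulKg.
Qed.

Lemma lambda_norm g xi : N (lam g xi) = N xi.
Proof.
rewrite /ell2norm /sqnorm; congr (Num.sqrt (fine _)).
rewrite (reindex_esum _ _ _ (fun h => (normc (xi h) ^+ 2)%:E) (mulg_bij g)).
by apply: eq_esum => h _; rewrite lambdaE ComplexField.Normc.normcM normc_cocycle mul1r.
Qed.

Lemma lambda_mul g h xi : lam g (lam h xi) = sigma g h *: lam (g * h)%g xi.
Proof.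
apply: ell2P => k; rewrite ell2ZE !lambdaE invgM -!mulgA.
have := cocycle_mul sigma g h (h^-1 * (g^-1 * k))%g; rewrite mulVKg.
by rewrite !mulrA => ->.
Qed.

Lemma lambda1 xi : lam 1%g xi = xi.
Proof. by apply: ell2P => h; rewrite lambdaE invg1 mul1g cocycle_1l mul1r. Qed.

Lemma rsum_reindex (f : G -> R) g : rsum (fun h => f (g^-1 * h)%g) = rsum f.
Proof.
rewrite /rsum; congr fine; congr (_ - _)%E.
  rewrite [RHS](reindex_esum _ _ _ _ (mulg_bij g)).
  by apply: eq_esum => h _; rewrite !funeposE.
rewrite [RHS](reindex_esum _ _ _ _ (mulg_bij g)).
by apply: eq_esum => h _; rewrite !funenegE.
Qed.

(** Inverse and adjoint of [lam g]; the scalar compensates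
    [lam g (lam g^-1 xi) = sigma g g^-1 *: xi]. *)
Definition lamV g xi := (sigma g g^-1%g)^*%C *: lam g^-1%g xi.

Lemma lamK g xi : lam g (lamV g xi) = xi.
Proof.
rewrite /lamV (linZ (@lambda_linear g)) lambda_mul mulgV lambda1 scalerA mulrC.
by rewrite cocycle_conj scale1r.
Qed.

Lemma lamV_norm g xi : N (lamV g xi) = N xi.
Proof. by rewrite ell2normZ lambda_norm normc_conj normc_cocycle mul1r. Qed.

Lemma lambda_adjoint g : adjoint_of (lam g) (lamV g).
Proof.
move=> xi eta; rewrite /dotp.
have E h : lam g xi h * (eta h)^*%C =
    xi (g^-1 * h)%g * (lamV g eta (g^-1 * h)%g)^*%C.
  rewrite lambdaE ell2ZE lambdaE invgK mulVKg !conjcM conjcK.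
  have := cocycle_mul sigma g g^-1%g h; rewrite mulgV cocycle_1l mulr1 => ->.
  rewrite -[LHS]mul1r -(cocycle_conj g^-1%g h); ring.
apply: complexP => /=.
  rewrite -[RHS](rsum_reindex _ g); congr rsum.
  by apply/funext => h; rewrite E.
rewrite -[RHS](rsum_reindex _ g); congr rsum.
by apply/funext => h; rewrite E.
Qed.

Definition comb (s : seq (R[i] * G)) xi : ell2 R G :=
  \sum_(p <- s) p.1 *: lam p.2 xi.

Lemma comb_cons p s xi : comb (p :: s) xi = p.1 *: lam p.2 xi + comb s xi.
Proof. by rewrite /comb big_cons. Qed.

Lemma comb_nil xi : comb [::] xi = 0.
Proof. by rewrite /comb big_nil. Qed.

Lemma comb_cat s t xi : comb (s ++ t) xi = comb s xi + comb t xi.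
Proof. by rewrite /comb big_cat. Qed.

Lemma bounded_lambda g : bounded_operator (lam g).
Proof.
by split; [exact: lambda_linear|exists 1 => xi; rewrite lambda_norm mul1r].
Qed.

Lemma bounded_comb s : bounded_operator (comb s).
Proof.
elim: s => [|p s IH].
  by have -> : comb [::] = 0; [apply/funext => xi; exact: comb_nil|exact: bounded_zero].
have -> : comb (p :: s) = p.1 *: lam p.2 + comb s.
  by apply/funext => xi; exact: comb_cons.
by apply: bounded_add => //; apply: bounded_scale; exact: bounded_lambda.
Qed.

Lemma comb_scale c s : exists t, forall xi, c *: comb s xi = comb t xi.
Proof.
elim: s => [|p s [t tE]]; first by exists [::] => xi; rewrite comb_nil scaler0.
by exists ((c * p.1, p.2) :: t) => xi; rewrite !comb_cons scalerDr scalerA tE.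
Qed.

Lemma comb_lambda g s : exists t, forall xi, lam g (comb s xi) = comb t xi.
Proof.
have lg := @lambda_linear g.
elim: s => [|p s [t tE]]; first by exists [::] => xi; rewrite !comb_nil (lin0 lg).
exists ((p.1 * sigma g p.2, (g * p.2)%g) :: t) => xi.
by rewrite !comb_cons (linD lg) (linZ lg) lambda_mul scalerA tE.
Qed.

Lemma comb_comp s s' : exists t, forall xi, comb s (comb s' xi) = comb t xi.
Proof.
elim: s => [|p s [t tE]]; first by exists [::] => xi; rewrite !comb_nil.
have [u uE] := comb_lambda p.2 s'; have [v vE] := comb_scale p.1 u.
by exists (v ++ t) => xi; rewrite comb_cons uE vE tE comb_cat.
Qed.

Lemma comb_adjoint s : exists t, adjoint_of (comb s) (comb t).
Proof.
elim: s => [|p s [t tE]].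
  by exists [::] => xi eta; rewrite !comb_nil dotp0l dotp0r.
exists (((p.1)^*%C * (sigma p.2 p.2^-1%g)^*%C, p.2^-1%g) :: t) => xi eta.
rewrite !comb_cons dotpDl dotpZl lambda_adjoint tE dotpDr -scalerA dotpZr conjcK.
by [].
Qed.

(** [cstar_generated], an intersection, offers no approximation of its elements. This explicit
    algebra contains the generators and so bounds it from above. *)
Definition comb_closure : set (ell2 R G -> ell2 R G) :=
  [set T | bounded_operator T /\
    forall e : R, 0 < e -> exists s, opbound e (T - comb s)].

Lemma cstar_comb_closure : cstar_subalgebra comb_closure.
Proof.
have half2 (e : R) : 0 < e -> 0 < e / 2 by move=> e0; rewrite divr_gt0.
split.
- by move=> T [].
- split; first exact: bounded_zero.
  move=> e e0; exists [::] => xi.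
  rewrite -[(0 - _) xi]/(0 - comb [::] xi) comb_nil subr0 ell2norm0.
  by rewrite mulr_ge0 ?ell2norm_ge0// ltW.
- move=> T S [bT aT] [bS aS]; split; first exact: bounded_add.
  move=> e /half2 e0; have [s sP] := aT _ e0; have [t tP] := aS _ e0.
  exists (s ++ t) => xi; rewrite -[(_ - _) xi]/(T xi + S xi - comb _ xi) comb_cat.
  rewrite opprD addrACA (le_trans (ell2norm_triangle _ _))// [e]splitr mulrDl.
  by apply: lerD; [exact: sP|exact: tP].
- move=> c T [bT aT]; split; first exact: bounded_scale.
  move=> e e0; have c0 : 0 < normc c + 1 by rewrite ltr_wpDl ?normc_ge0.
  have [s sP] := aT _ (divr_gt0 e0 c0); have [t tE] := comb_scale c s.
  exists t => xi; rewrite -[(_ - _) xi]/(c *: T xi - comb t xi) -tE -scalerBr ell2normZ.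
  apply: (@le_trans _ _ ((normc c + 1) * (e / (normc c + 1) * N xi))).
    by apply: ler_pM; rewrite ?normc_ge0 ?ell2norm_ge0 ?lerDl//; exact: sP.
  by rewrite mulrA [_ * (e / _)]mulrC divfK// gt_eqF.
- move=> T S [bT aT] [bS aS]; split; first exact: bounded_comp.
  move=> e e0; have [lT _] := bT; have [lS [M0 SM0]] := bS.
  pose M := `|M0| + 1; have Mp : 0 < M by rewrite ltr_wpDl.
  have SM xi : N (S xi) <= M * N xi.
    rewrite (le_trans (SM0 xi))// ler_wpM2r ?ell2norm_ge0//.
    by rewrite (le_trans (ler_norm _))// lerDl.
  have [s sP] := aT _ (divr_gt0 (half2 _ e0) Mp).
  have [_ [K0 sK0]] := bounded_comb s.
  pose K := `|K0| + 1; have Kp : 0 < K by rewrite ltr_wpDl.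
  have sK xi : N (comb s xi) <= K * N xi.
    rewrite (le_trans (sK0 xi))// ler_wpM2r ?ell2norm_ge0//.
    by rewrite (le_trans (ler_norm _))// lerDl.
  (* [t] is chosen after [s], because its error gets multiplied by the bound [K] of [comb s]. *)
  have [t tP] := aS _ (divr_gt0 (half2 _ e0) Kp).
  have [u uE] := comb_comp s t; have [ls _] := bounded_comb s.
  exists u => xi; rewrite -[(_ - _) xi]/(T (S xi) - comb u xi) -uE.
  have -> : T (S xi) - comb s (comb t xi) =
      (T - comb s) (S xi) + comb s ((S - comb t) xi).
    rewrite -[(T - _) _]/(T (S xi) - comb s (S xi)).
    rewrite -[(S - _) _]/(S xi - comb t xi) (linB ls).
    by rewrite addrA subrK.
  rewrite (le_trans (ell2norm_triangle _ _))// [e]splitr mulrDl.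
  apply: lerD.
    apply: le_trans (sP _) _; apply: (@le_trans _ _ (e / 2 / M * (M * N xi))).
      by rewrite ler_wpM2l// divr_ge0// ltW// half2.
    by rewrite mulrA divfK// gt_eqF.
  apply: le_trans (sK _) _; rewrite mulrC -ler_pdivlMr//.
  by rewrite mulrAC; exact: tP.
- move=> T S [bT aT] bS TS; split; [exact: bS|move=> e e0]; have [s sP] := aT _ e0.
  have [t tP] := comb_adjoint s; exists t => eta.
  set zeta := (S - comb t) eta.
  (* [zeta] is the image of [eta] under the adjoint of [T - comb s]; pairing it with itself
     transfers the bound from the operator to its adjoint. *)
  have : dotp zeta zeta = dotp ((T - comb s) zeta) eta.
    rewrite -[(T - _) _]/(T zeta - comb s zeta) dotpBl TS tP.
    by rewrite [in X in dotp _ X = _]/zeta -[(S - _) _]/(S eta - comb t eta) dotpBr.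
  rewrite dotpxx => E; have := cauchy_schwarz ((T - comb s) zeta) eta.
  rewrite -E /= expr0n addr0 sqrtr_sqr ger0_norm ?sqr_ge0// => le.
  have [->|z0] := eqVneq (N zeta) 0.
    by rewrite mulr_ge0 ?ell2norm_ge0// ltW.
  have zp : 0 < N zeta by rewrite lt_def z0 ell2norm_ge0.
  rewrite -(ler_pM2l zp) -expr2 (le_trans le)// mulrA.
  by rewrite ler_wpM2r ?ell2norm_ge0// [N zeta * e]mulrC; exact: sP.
- move=> T bT aT; split=> // e /half2 e0.
  have [S [bS aS] TS] := aT _ e0; have [s sP] := aS _ e0.
  have {}TS := opbound_lt (bounded_sub bT bS) TS.
  exists s => xi; rewrite -[(_ - _) xi]/(T xi - comb s xi) -(subrK (S xi) (T xi)).
  rewrite -addrA (le_trans (ell2norm_triangle _ _))// [e]splitr mulrDl.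
  by apply: lerD; [exact: TS|exact: sP].
Qed.

Lemma lambda_reduced (H : {pred G}) h : h \in H -> reduced_cstar sigma H (lam h).
Proof. by move=> hH A [_]; apply; exists h. Qed.

Lemma reduced_cstar_comb : reduced_cstar sigma predT `<=` comb_closure.
Proof.
move=> T; apply; split; first exact: cstar_comb_closure.
move=> _ [g _ <-]; split; first exact: bounded_lambda.
move=> e e0; exists [:: (1, g)] => xi.
rewrite -[(_ - _) xi]/(lam g xi - comb _ xi) comb_cons comb_nil /= scale1r addr0.
by rewrite subrr ell2norm0 mulr_ge0 ?ell2norm_ge0// ltW.
Qed.

Lemma norm_delta (k : G) : N (delta R k) = 1.
Proof.
apply/eqP; rewrite -(@eqrXn2 _ 2) ?ell2norm_ge0// expr1n; apply/eqP.
by apply: (@complexI R); rewrite -dotpxx dotp_delta deltaE eqxx.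
Qed.

Lemma coord_opbound e T k h : opbound e T -> normc (T (delta R k) h) <= e.
Proof.
move=> Te; rewrite (le_trans (normc_coord_le _ _))// (le_trans (Te _))//.
by rewrite norm_delta mulr1.
Qed.

Lemma comb_coord s k h : comb s (delta R k) h =
  sigma (h * k^-1)%g k * comb s (delta R 1%g) (h * k^-1)%g.
Proof.
elim: s => [|p s IH]; first by rewrite !comb_nil !ell20E mulr0.
rewrite !comb_cons !ell2DE IH mulrDr; congr (_ + _).
rewrite !ell2ZE !lambdaE !deltaE.
have [E|E] := eqVneq (p.2^-1 * h)%g k.
  rewrite -E invgM invgK mulgA mulgV mul1g mulVg eqxx cocycle_1r !mulr1.
  by rewrite mulrC.
rewrite ifF ?mulr0//; apply: contra_neqF E => /eqP E.
by apply: (mulIg k^-1%g); rewrite mulgV -mulgA.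
Qed.

(* Elements of the closure are determined by their first column: they commute
   with twisted right translations. *)
Lemma comb_closure_coord T k h : comb_closure T -> T (delta R k) h =
  sigma (h * k^-1)%g k * T (delta R 1%g) (h * k^-1)%g.
Proof.
move=> [_ aT]; apply/eqP; rewrite -subr_eq0; apply/eqP.
apply: ComplexField.Normc.eq0_normc; apply/eqP; rewrite eq_le normc_ge0 andbT.
apply/ler_addgt0Pl => e e0; rewrite ?addr0 ?add0r.
have e2 : 0 < e / 2 by rewrite divr_gt0.
have [s sP] := aT _ e2; set m := (h * k^-1)%g.
have -> : T (delta R k) h - sigma m k * T (delta R 1%g) m =
    (T - comb s) (delta R k) h - sigma m k * (T - comb s) (delta R 1%g) m.
  rewrite -![(T - _) _ _]/(T _ _ - comb s _ _) comb_coord -/m; ring.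
apply: le_trans (le_normcD _ _) _; rewrite normcN.
rewrite ComplexField.Normc.normcM normc_cocycle mul1r [e]splitr.
by apply: lerD; exact: coord_opbound.
Qed.

(** The vector [delta 1] is separating, which is faithfulness of the trace. *)
Lemma comb_closure_eq0 T : comb_closure T -> T (delta R 1%g) = 0 -> T = 0.
Proof.
move=> cT T0; have [[lT [M TM]] _] := cT.
apply/funext => xi; apply: ell2P => h; rewrite -[RHS]/(0 : R[i]).
apply: (@functional_eq0 _ _ (fun xi => T xi h) M) => [x y|c x|x|j].
- by rewrite (linD lT).
- by rewrite (linZ lT).
- exact: le_trans (normc_coord_le _ _) (TM x).
- by rewrite (comb_closure_coord _ _ cT) T0 ell20E mulr0.
Qed.

Lemma sum_norm_disjoint (D : nat -> set G) (x : nat -> ell2 R G) n :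
  (forall i j k, D i k -> D j k -> i = j) ->
  (forall i k, ~ D i k -> x i k = 0) ->
  N (\sum_(i < n) x i) ^+ 2 = \sum_(i < n) N (x i) ^+ 2.
Proof.
move=> dj supp; elim: n => [|n IH]; first by rewrite !big_ord0 ell2norm0 expr0n.
rewrite !big_ord_recr /= ell2norm_orth ?IH//; apply: dotp_disjoint => k.
have [Dk|/supp] := pselect (D n k); [left|by right].
have : forall m, (m <= n)%N -> (\sum_(i < m) x i) k = 0.
  elim=> [|m IHm] mn; first by rewrite big_ord0.
  have -> : \sum_(i < m.+1) x i = \sum_(i < m) x i + x m by rewrite big_ord_recr.
  rewrite ell2DE IHm ?(ltnW mn)// add0r supp// => Dm.
  by have := dj _ _ _ Dm Dk => E; rewrite E ltnn in mn.
by apply.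
Qed.

Lemma sqr_sum_le (x : nat -> R) n :
  (\sum_(i < n) x i) ^+ 2 <= n%:R * \sum_(i < n) x i ^+ 2.
Proof.
elim: n => [|n IH]; first by rewrite !big_ord0 expr0n mulr0.
rewrite !big_ord_recr /=; have [->|n_gt0] := posnP n.
  by rewrite !big_ord0 !add0r mul1r.
have n0 : 0 < n%:R :> R by rewrite ltr0n.
set a := \sum_(i < n) _ in IH *; set q := \sum_(i < n) _ in IH *.
rewrite -(ler_pM2l n0) -natr1; set m : R := n%:R in n0 IH *.
set y := x _; have h2 : 0 <= (a - m * y) ^+ 2 by exact: sqr_ge0.
have h1 : 0 <= m * (m * q) - m * a ^+ 2 by rewrite subr_ge0 ler_wpM2l// ltW.
rewrite -subr_ge0.
have -> : m * ((m + 1) * (q + y ^+ 2)) - m * (a + y) ^+ 2 =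
  (m * (m * q) - m * a ^+ 2) + (m * q - a ^+ 2) + (a - m * y) ^+ 2 by ring.
have h3 : 0 <= m * q - a ^+ 2 by rewrite subr_ge0.
by rewrite addr_ge0// addr_ge0.
Qed.

(* Powers' estimate: outside [D i] the operator [lam (t i)] only sees the
   restriction to [D i], so that the sum splits into one sum with disjoint
   ranges and one with disjoint supports. *)
Lemma powers_bound (n : nat) (t : nat -> G) (w : nat -> R[i]) (D : nat -> set G) xi :
  (forall i, normc (w i) = 1) ->
  (forall i j k, D i k -> D j k -> i = j) ->
  (forall i k, ~ D i k -> D i ((t i)^-1 * k)%g) ->
  N (\sum_(i < n) w i *: lam (t i) xi) <= 2 * Num.sqrt n%:R * N xi.
Proof.
move=> w1 dj Dt; pose u i := w i *: lam (t i) xi.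
have uN i : N (u i) = N xi by rewrite ell2normZ w1 mul1r lambda_norm.
pose a i := restr (D i) (u i); pose b i := restr (~` D i) (u i).
pose p i := restr (D i) xi.
have -> : \sum_(i < n) w i *: lam (t i) xi = \sum_(i < n) a i + \sum_(i < n) b i.
  by rewrite -big_split /=; apply: eq_bigr => i _; rewrite restrK.
have sn : 0 <= Num.sqrt n%:R :> R by exact: sqrtr_ge0.
have sqn : Num.sqrt n%:R ^+ 2 = n%:R :> R by rewrite sqr_sqrtr.
have leS (x : R) : x ^+ 2 <= n%:R * N xi ^+ 2 -> x <= Num.sqrt n%:R * N xi.
  move=> le; have [x0|/ltW x0] := leP 0 x; last first.
    by rewrite (le_trans x0)// mulr_ge0 ?ell2norm_ge0.
  rewrite -(@ler_pXn2r _ 2) ?nnegrE ?mulr_ge0 ?ell2norm_ge0//.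
  by rewrite exprMn sqn.
rewrite (le_trans (ell2norm_triangle _ _))// -mulrA mulr_natl mulr2n.
apply: lerD; apply: leS.
  rewrite (@sum_norm_disjoint D a n dj); last by move=> i k Dk; rewrite restr_out.
  apply: (@le_trans _ _ (\sum_(i < n) N xi ^+ 2)).
    apply: ler_sum => i _; rewrite ler_pXn2r ?nnegrE ?ell2norm_ge0//.
    by rewrite -(uN i) norm_restr_le.
  by rewrite sumr_const card_ord mulr_natl.
have bp i : N (b i) <= N (p i).
  have -> : b i = restr (~` D i) (w i *: lam (t i) (p i)).
    apply: ell2P => k; have [Dk|Dk] := pselect (D i k).
      by rewrite !restr_out//; apply.
    by rewrite !restr_in// !ell2ZE !lambdaE restr_in//; exact: Dt.
  by rewrite (le_trans (norm_restr_le _ _))// ell2normZ w1 mul1r lambda_norm.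
have sb m : N (\sum_(i < m) b i) <= \sum_(i < m) N (p i).
  elim: m => [|m IH]; first by rewrite !big_ord0 ell2norm0.
  by rewrite !big_ord_recr /= (le_trans (ell2norm_triangle _ _))// lerD.
(* Bessel's inequality: [z], the sum of the [p i], is an orthogonal projection of [xi], so
   [dotp z xi] is [N z ^+ 2]. *)
have sp : \sum_(i < n) N (p i) ^+ 2 <= N xi ^+ 2.
  have E := @sum_norm_disjoint D p n dj (fun i k Dk => restr_out xi Dk).
  set z := \sum_(i < n) p i in E.
  have zx m : dotp (\sum_(i < m) p i) xi = ((\sum_(i < m) N (p i) ^+ 2)%:C)%C.
    elim: m => [|m IH]; first by rewrite !big_ord0 dotp0l.
    rewrite !big_ord_recr /= dotpDl IH RCD -dotpxx; congr (_ + _).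
    rewrite -[in LHS](restrK (D m) xi) dotpDr [X in _ + X]dotp_disjoint ?addr0//.
    by move=> k; have [Dk|Dk] := pselect (D m k); [right|left]; exact: restr_out.
  have := cauchy_schwarz z xi; rewrite zx -E /= expr0n addr0 sqrtr_sqr ger0_norm ?sqr_ge0//.
  have [->|z0] := eqVneq (N z) 0; first by rewrite expr0n sqr_ge0.
  have zp : 0 < N z by rewrite lt_def z0 ell2norm_ge0.
  by rewrite expr2 ler_pM2l// => le; rewrite -expr2 ler_pXn2r ?nnegrE ?ell2norm_ge0.
apply: le_trans (_ : (\sum_(i < n) N (p i)) ^+ 2 <= _).
  by rewrite ler_pXn2r ?nnegrE ?ell2norm_ge0// sumr_ge0// => i _; exact: ell2norm_ge0.
by rewrite (le_trans (sqr_sum_le (fun i => N (p i)) n))// ler_wpM2l.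
Qed.

End TwistedConvolution.

(** * Averages of conjugates and simplicity of intermediate algebras *)

Section Averaging.
Variables (R : realType) (G : groupType) (sigma : two_cocycle R G).
Implicit Types (xi eta : ell2 R G) (c : R[i]) (T S : ell2 R G -> ell2 R G).
Implicit Types (h : nat -> G) (n k : nat) (M : R).
Local Notation N := (@ell2norm R G).
Local Notation lam := (lambda sigma).

(** With [lamV] each term is an exact conjugation, so the identity is preserved for every
    cocycle. *)
Definition average (h : nat -> G) (n : nat) T xi : ell2 R G :=
  ((n%:R^-1)%:C)%C *: \sum_(i < n) lam (h i) (T (lamV sigma (h i) xi)).

Lemma normc_real (x : R) : 0 <= x -> normc (x%:C)%C = x.
Proof. by move=> x0; rewrite /= expr0n addr0 sqrtr_sqr ger0_norm. Qed.

Lemma average_norm h n T xi (b : R) : (0 < n)%N ->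
  N (\sum_(i < n) lam (h i) (T (lamV sigma (h i) xi))) <= n%:R * b ->
  N (average h n T xi) <= b.
Proof.
move=> n0 le; rewrite ell2normZ normc_real ?invr_ge0//.
by rewrite ler_pdivrMl ?ltr0n.
Qed.

Lemma average_opbound h n T M : (0 < n)%N -> opbound M T ->
  opbound M (average h n T).
Proof.
move=> n0 TM xi; apply: average_norm => //.
elim: n {n0} => [|n IH]; first by rewrite big_ord0 ell2norm0 mul0r.
rewrite big_ord_recr /= -natr1 mulrDl mul1r (le_trans (ell2norm_triangle _ _))//.
by rewrite lerD// lambda_norm (le_trans (TM _))// lamV_norm.
Qed.

Lemma averageD h n T S xi :
  average h n (fun x => T x + S x) xi = average h n T xi + average h n S xi.
Proof.
rewrite /average -scalerDr -big_split /=; congr (_ *: _).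
by apply: eq_bigr => i _; rewrite (linD (@lambda_linear _ _ sigma _)).
Qed.

Lemma averageZ h n c T xi :
  average h n (fun x => c *: T x) xi = c *: average h n T xi.
Proof.
rewrite /average !scalerA mulrC -scalerA; congr (_ *: _).
rewrite scaler_sumr; apply: eq_bigr => i _.
by rewrite (linZ (@lambda_linear _ _ sigma _)).
Qed.

Lemma average_id h n xi : (0 < n)%N -> average h n id xi = xi.
Proof.
move=> n0; rewrite /average (eq_bigr (fun=> xi)) => [|i _]; last exact: lamK.
rewrite sumr_const card_ord -scaler_nat scalerA.
have -> : (n%:R : R[i]) = ((n%:R : R)%:C)%C by rewrite rmorph_nat.
by rewrite -rmorphM mulVf ?pnatr_eq0 -?lt0n// scale1r.
Qed.

(** Powers' estimate with [D i] the translate by [h i] of the complement of [C]; conjugation turns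
    [lam f] into [lam (t i)] up to the unimodular [w i]. *)
Lemma average_lambda (C : set G) h k f xi : (forall g, C g -> ~ C (f * g)%g) ->
  (forall m n g, ~ C ((h m)^-1 * g)%g -> ~ C ((h n)^-1 * g)%g -> m = n) ->
  N (average h (k.+1 ^ 2) (lam f) xi) <= 2 / k.+1%:R * N xi.
Proof.
move=> Cf hC; apply: average_norm; first by rewrite expn_gt0.
pose w i := (sigma (h i) (h i)^-1%g)^*%C *
  (sigma (h i) f * sigma (h i * f)%g (h i)^-1%g).
pose t i := (h i * f * (h i)^-1)%g.
have E i : lam (h i) (lam f (lamV sigma (h i) xi)) = w i *: lam (t i) xi.
  rewrite /lamV !(linZ (@lambda_linear _ _ sigma _)) !lambda_mul.
  by rewrite /w /t -!scalerA.
rewrite (eq_bigr (fun i : 'I__ => w i *: lam (t i) xi)) => [|i _]; last exact: E.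
apply: le_trans (@powers_bound _ _ _ _ t w
  (fun i => [set g | ~ C ((h i)^-1 * g)%g]) xi _ _ _) _ => //.
- move=> i; rewrite /w !ComplexField.Normc.normcM normc_conj !normc_cocycle.
  by rewrite !mulr1.
- move=> i g /contrapT Cg /= Ctg.
  have Eg : ((h i)^-1 * ((t i)^-1 * g) = f^-1 * ((h i)^-1 * g))%g.
    by rewrite /t !invgM invgK !mulgA mulVg mul1g.
  by rewrite Eg in Ctg; apply: (Cf _ Ctg); rewrite mulVKg.
rewrite natrX sqrtr_sqr ger0_norm//.
rewrite mulrA ler_wpM2r ?ell2norm_ge0// expr2 mulrCA -mulrA mulfV ?pnatr_eq0//.
by rewrite mulr1 mulrC.
Qed.

Lemma average_comb (C : set G) h k s xi :
  (forall p g, p \in s -> C g -> ~ C (p.2 * g)%g) ->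
  (forall m n g, ~ C ((h m)^-1 * g)%g -> ~ C ((h n)^-1 * g)%g -> m = n) ->
  N (average h (k.+1 ^ 2) (comb sigma s) xi) <=
  (\sum_(p <- s) normc p.1) * (2 / k.+1%:R) * N xi.
Proof.
move=> sC hC; elim: s sC => [|p s IH] sC.
  rewrite big_nil !mul0r (_ : average _ _ _ _ = 0) ?ell2norm0//.
  rewrite /average big1 ?scaler0// => i _.
  by rewrite comb_nil (lin0 (@lambda_linear _ _ sigma _)).
have -> : comb sigma (p :: s) = (fun x => p.1 *: lam p.2 x + comb sigma s x).
  by apply/funext => x; exact: comb_cons.
rewrite averageD averageZ big_cons (le_trans (ell2norm_triangle _ _))//.
rewrite [(_ + _) * (2 / _)]mulrDl [leRHS]mulrDl.
apply: lerD; last by apply: IH => q g qs; apply: sC; rewrite inE qs orbT.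
rewrite ell2normZ -mulrA ler_wpM2l ?normc_ge0//.
apply: average_lambda hC => g; apply: sC; exact: mem_head.
Qed.

(* [1 - (1 - z)^n] lies in the ideal and tends to [1]. *)
Lemma ideal_id (C J : set (ell2 R G -> ell2 R G)) z :
  cstar_subalgebra C -> C id -> closed_ideal C J -> J z ->
  opbound (3 / 4) (id - z) -> J id.
Proof.
move=> hC C1 hJ Jz zb.
(* [1 - (1 - z)^n], written without the identity, which is not yet known to lie in [J]. *)
pose E n := iter n (fun T => T + (z - (T \o z))) (0 : ell2 R G -> ell2 R G).
have JE n : J (E n).
  elim: n => [|n IH]; first exact: (ideal_zero hJ).
  rewrite -[E n.+1]/(E n + (z - (E n \o z))).
  have JEz : J (E n \o z) by apply: (ideal_mull hJ) => //; exact: (ideal_sub hJ).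
  apply: (ideal_add hJ) => //; apply: (ideal_add hJ) => //.
  by rewrite -scaleN1r; exact: (ideal_scale hJ).
have lE n : linear (E n) by have [] := cstar_bounded hC (ideal_sub hJ (JE n)).
have bE n : opbound ((3 / 4) ^+ n) (id - E n).
  elim: n => [|n IH] xi.
    by rewrite expr0 mul1r -[(_ - _) _]/(xi - 0) subr0.
  have -> : (id - E n.+1) xi = (id - E n) ((id - z) xi).
    rewrite -[LHS]/(xi - (E n xi + (z xi - E n (z xi)))).
    rewrite -[RHS]/(xi - z xi - E n (xi - z xi)) (linB (lE n)).
    by rewrite !opprD !opprK [- E n xi + _]addrCA !addrA.
  apply: le_trans (IH _) _; rewrite exprSr -mulrA; apply: ler_wpM2l; last exact: zb.
  by rewrite exprn_ge0// divr_ge0.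
apply: (norm_closed_opbound (ideal_closed hJ) (bounded_id _ _)) => e e0.
(* Bernoulli's inequality; any [n > 3 / e] then makes [(3 / 4) ^+ n] smaller than [e]. *)
have bern n : 1 + n%:R / 3 <= (4 / 3 : R) ^+ n.
  elim: n => [|n IH]; first by rewrite mul0r addr0 expr0.
  rewrite exprS -natr1; have := ler0n R n; move: (n%:R : R) IH => x; nra.
have [n nP] : exists n : nat, 3 / e < n%:R.
  by exists (Num.truncn (3 / e)).+1; exact: truncnS_gt.
exists (E n) => // xi; rewrite (le_trans (bE n xi))// ler_wpM2r ?ell2norm_ge0//.
have q0 : 0 < (4 / 3 : R) ^+ n by rewrite exprn_gt0// divr_gt0.
have -> : (3 / 4 : R) ^+ n = ((4 / 3) ^+ n)^-1 by rewrite -exprVn invf_div.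
rewrite -(ler_pM2r q0) mulVf ?gt_eqF//.
apply: (@le_trans _ _ (e * (1 + n%:R / 3))); last by rewrite ler_wpM2l// ltW.
move: nP; rewrite ltr_pdivrMr//; move: (n%:R : R) => x; nra.
Qed.

(** No tree is left here: a combinatorial property of [H] in [G] suffices, for any cocycle. *)
Theorem powers_cstar_irreducible (H : {pred G}) : group_closed H ->
  (forall s : seq G, (forall f, f \in s -> f <> 1%g) ->
    exists (C : set G) (h : nat -> G),
    [/\ forall n, h n \in H, forall f g, f \in s -> C g -> ~ C (f * g)%g &
        forall m n g, ~ C ((h m)^-1 * g)%g -> ~ C ((h n)^-1 * g)%g -> m = n]) ->
  cstar_irreducible sigma H.
Proof.
move=> [H1 Hdiv] powers C hC HC CG.
have HV x : x \in H -> (x^-1)%g \in H by move=> xH; rewrite -[(x^-1)%g]mul1g Hdiv.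
have Cl g : g \in H -> C (lam g) by move=> gH; apply: HC; exact: lambda_reduced.
have ClV g : g \in H -> C (lamV sigma g).
  by move=> gH; apply: (cstar_scale hC); exact: Cl (HV _ gH).
have C1 : C id.
  by have := Cl _ H1; rewrite (_ : lam 1%g = id)//; apply/funext => xi; exact: lambda1.
split=> [E|J hJ].
  have : [set 0] (id : ell2 R G -> ell2 R G) by rewrite -E.
  move/(congr1 (fun T => T (delta R 1%g) 1%g)) => /=.
  by rewrite eqxx => /eqP; rewrite oner_eq0.
have [J0|Jn0] := pselect (forall x, J x -> x = 0).
  by left; apply/seteqP; split=> [x /J0//|_ ->]; exact: (ideal_zero hJ).
right; apply/seteqP; split; first exact: (ideal_sub hJ).
suff J1 : J id.
  by move=> T CT; have := ideal_mull hJ CT J1; rewrite (_ : T \o id = T).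
have [x [Jx x0]] : exists x, J x /\ x <> 0.
  apply: contrapT => h; apply: Jn0 => x Jx; apply: contrapT => x0.
  by apply: h; exists x.
have Cx := ideal_sub hJ Jx.
have [xs bxs adx] := adjoint_exists (cstar_bounded hC Cx).
have Jy : J (xs \o x) by apply: (ideal_mull hJ) => //; exact: (cstar_adjoint hC Cx).
have xd0 : N (x (delta R 1%g)) != 0.
  apply/eqP => /ell2norm_eq0 /comb_closure_eq0 h; apply: x0; apply: h.
  by apply: reduced_cstar_comb; exact: CG.
set a := N (x (delta R 1%g)) in xd0.
pose y := (((a ^+ 2)^-1)%:C)%C *: (xs \o x).
have {}Jy : J y by exact: (ideal_scale hJ).
(* The trace of [xs \o x] is [a ^+ 2], hence the normalization in [y]. *)
have yd : y (delta R 1%g) 1%g = 1.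
  rewrite -[LHS]/((((a ^+ 2)^-1)%:C)%C * (xs (x (delta R 1%g))) 1%g).
  rewrite -[X in _ * X]dotp_delta dotpC -adx dotpxx -/a conjc_real -rmorphM.
  by rewrite mulVf// expf_neq0.
have [_ /(_ (1 / 4))[|s sP]] := reduced_cstar_comb (CG _ (ideal_sub hJ Jy)).
  by rewrite divr_gt0.
(* A list may contain the identity of [G] several times; [alpha] collects its total coefficient,
   which is within [1/4] of the trace of [y]. *)
pose s' := [seq p <- s | p.2 != 1%g]; pose alpha := \sum_(p <- s | p.2 == 1%g) p.1.
have sE xi : comb sigma s xi = alpha *: xi + comb sigma s' xi.
  rewrite /comb /s' big_filter /alpha (bigID (fun p => p.2 == 1%g)) /=.
  congr (_ + _); rewrite scaler_suml; apply: eq_bigr => p /eqP ->.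
  by rewrite lambda1.
have alphaP : normc (1 - alpha) <= 1 / 4.
  have := coord_opbound 1%g 1%g sP.
  rewrite -[(y - _) _ _]/(y (delta R 1%g) 1%g - comb sigma s (delta R 1%g) 1%g).
  rewrite yd sE ell2DE ell2ZE deltaE eqxx mulr1 (_ : comb _ _ _ _ = 0) ?addr0//.
  rewrite /s' {}/sE; elim: (s) => [|p t IH] /=; first by rewrite comb_nil ell20E.
  case: ifP => // p1; rewrite comb_cons ell2DE ell2ZE IH addr0 lambdaE deltaE mulg1.
  by rewrite invg_eq1 (negPf p1) !mulr0.
have [f|P [h [hH hP hD]]] := powers [seq p.2 | p <- s'].
  by move=> /mapP[p]; rewrite mem_filter => /andP[/eqP p1 _] ->.
pose K := \sum_(p <- s') normc p.1.
have K0 : 0 <= K by apply: sumr_ge0 => p _; exact: normc_ge0.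
(* Makes the averaged remainder, of norm at most [K * (2 / k.+1)], smaller than [1/4]. *)
have [k kP] : exists k : nat, 8 * K < k.+1%:R.
  by exists (Num.truncn (8 * K)); exact: truncnS_gt.
have n0 : (0 < k.+1 ^ 2)%N by rewrite expn_gt0.
apply: (@ideal_id C J (average h (k.+1 ^ 2) y)) => //.
  rewrite /average; move: (k.+1 ^ 2)%N => n.
  (* [J] is an ideal of [C] only, so the conjugating unitaries must lie in [C]: this is why the
     [h i] are taken in [H]. *)
  have Jsum : J (fun xi => \sum_(i < n) lam (h i) (y (lamV sigma (h i) xi))).
    elim: n => [|n IH].
      rewrite (_ : (fun xi => _) = 0); first exact: (ideal_zero hJ).
      by apply/funext => xi; rewrite big_ord0.
    have := ideal_add hJ IH (ideal_mulr hJ (ideal_mull hJ (Cl _ (hH n)) Jy) (ClV _ (hH n))).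
    by congr J; apply/funext => xi; rewrite big_ord_recr.
  exact: (ideal_scale hJ _ Jsum).
move=> xi; rewrite -[(_ - _) xi]/(xi - average h (k.+1 ^ 2) y xi).
(* The three errors: [u] from approximating [y], [1 - alpha] from the trace, and the average of
   [comb sigma s']. *)
have [u [uP ->]] : exists u, opbound (1 / 4) u /\
    y = (fun x => u x + (alpha *: x + comb sigma s' x)).
  exists (y - comb sigma s); split=> //; apply/funext => x'.
  by rewrite -sE -[(_ - _) x']/(y x' - comb sigma s x') subrK.
rewrite !averageD averageZ average_id//.
have -> : forall v w : ell2 R G, xi - (v + (alpha *: xi + w)) = (1 - alpha) *: xi - v - w.
  by move=> v w; rewrite scalerBl scale1r !opprD [- v + _]addrCA !addrA.
apply: le_trans (ell2norm_triangle _ _) _; rewrite ell2normN.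
have -> : 3 / 4 * N xi = (1 / 4 * N xi + 1 / 4 * N xi) + 1 / 4 * N xi by field.
apply: lerD.
  apply: le_trans (ell2norm_triangle _ _) _; rewrite ell2normN.
  apply: lerD; last exact: (average_opbound h n0 uP xi).
  by rewrite ell2normZ ler_wpM2r ?ell2norm_ge0.
apply: le_trans (average_comb _ _ _ hD) _ => [p g ps|].
  by apply: hP; apply: map_f.
rewrite ler_wpM2r ?ell2norm_ge0// -/K mulrA ler_pdivrMr ?ltr0n//; lra.
Qed.

End Averaging.

Theorem corollary8p4 (R : realType) (G : groupType)
    (V : eqType) (adj : rel V) (act : G -> V -> V) (H : {pred G}) :
  is_tree adj -> tree_action adj act ->
  strongly_faithful act -> minimal_action adj act -> general_type adj act ->
  normal_subgroup H -> nontrivial_subgroup H ->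
  cstar_irreducible (trivial_cocycle R G) H /\
  forall sigma : two_cocycle R G, cstar_irreducible sigma H.
Proof.
move=> treeV actV sfV minV gtV nH ntH.
have irr (sigma : two_cocycle R G) : cstar_irreducible sigma H.
  apply: powers_cstar_irreducible; first by case: nH.
  by move=> s sP; apply: (relative_powers treeV actV minV gtV sfV nH ntH sP).
by split.
Qed.
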